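(* For every $n\in\mathbb N$, the $4$-input $2$-output bipartite strategy $$\mathcal S_n=\Big(|\phi_n\rangle;\ (\mathfrak P^{(n)}_i,I-\mathfrak P^{(n)}_i)_{i=1}^4;\ (\mathfrak P^{(n)}_i,I-\mathfrak P^{(n)}_i)_{i=1}^4\Big)$$ is self-tested by its correlation.
   Context: A bipartite strategy $\mathcal S=(|\psi\rangle;\mathcal M_1,\dots,\mathcal M_{N_A};\mathcal N_1,\dots,\mathcal N_{N_B})$ consists of finite-dimensional Hilbert spaces $\mathcal H_A,\mathcal H_B$, a unit vector $|\psi\rangle\in\mathcal H_A\otimes\mathcal H_B$, POVMs $\mathcal M_i=(\mathcal M_{i,a})_a$ on $\mathcal H_A$ and POVMs $\mathcal N_j=(\mathcal N_{j,b})_b$ on $\mathcal H_B$ (tuples of positive semidefinite operators summing to $I$). It is $(N_A,N_B)$-input and has the given numbers of outcomes; ''$N$-input $K$-output'' means $N_A=N_B=N$ and all measurements have $K$ outcomes. Its correlation is $p(a,b|i,j)=\langle\psi|\mathcal M_{i,a}\otimes\mathcal N_{j,b}|\psi\rangle$. A strategy $\widetilde{\mathcal S}=(|\widetilde\psi\rangle;\widetilde{\mathcal M};\widetilde{\mathcal N})$ on $\widetilde{\mathcal H}_A\otimes\widetilde{\mathcal H}_B$ (with the same numbers of inputs and outputs) is a local dilation of $\mathcal S$ if there exist finite-dimensional Hilbert spaces $\mathcal K_A,\mathcal K_B$, a state $|\mathrm{aux}\rangle\in\mathcal K_A\otimes\mathcal K_B$ and isometries $U_A:\mathcal H_A\to\widetilde{\mathcal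 H}_A\otimes\mathcal K_A$, $U_B:\mathcal H_B\to\widetilde{\mathcal H}_B\otimes\mathcal K_B$ with $(U_A\otimes U_B)(\mathcal M_{i,a}\otimes\mathcal N_{j,b})|\psi\rangle=(\widetilde{\mathcal M}_{i,a}\otimes\widetilde{\mathcal N}_{j,b})|\widetilde\psi\rangle\otimes|\mathrm{aux}\rangle$ for all $i,j,a,b$ (identifying $(\widetilde{\mathcal H}_A\otimes\mathcal K_A)\otimes(\widetilde{\mathcal H}_B\otimes\mathcal K_B)$ with $(\widetilde{\mathcal H}_A\otimes\widetilde{\mathcal H}_B)\otimes(\mathcal K_A\otimes\mathcal K_B)$). $\widetilde{\mathcal S}$ is self-tested by its correlation if it is a local dilation of every strategy with the same numbers of inputs and outputs and the same correlation. $|\phi_n\rangle=\frac1{\sqrt n}\sum_{i=1}^n|i\rangle|i\rangle\in\mathbb C^n\otimes\mathbb C^n$. For $n\in\mathbb N$, $\mathfrak P^{(n)}_1,\dots,\mathfrak P^{(n)}_4\in M_n(\mathbb R)$ denote orthogonal projections (real symmetric idempotent matrices) such that (i) $\mathfrak P^{(n)}_1+\dots+\mathfrak P^{(n)}_4=(2-\frac1n)I_n$; (ii) $\operatorname{rk}\mathfrak P^{(n)}_1=\lfloor\frac n2\rfloor-(-1)^n$ and $\operatorname{rk}\mathfrak P^{(n)}_i=\lfloor\frac n2\rfloor$ for $i=2,3,4$; (iii) the only subspaces of $\mathbb C^n$ invariant under all four matrices are $0$ and $\mathbb C^n$. Such quadruples exist for every $n$, and any two of them are simultaneously unitarily equivalent.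 *)

(* Defs.v *)
From HB Require Import structures.
From mathcomp Require Import all_boot all_order all_algebra.
From mathcomp Require Import reals.
From mathcomp.real_closed Require Import complex mxtens.

Set Implicit Arguments.
Unset Strict Implicit.
Unset Printing Implicit Defensive.

Import Order.TTheory GRing.Theory Num.Theory.
Local Open Scope ring_scope.

Definition adjmx {C : numClosedFieldType} {m n : nat} (A : 'M[C]_(m, n))
  : 'M[C]_(n, m) := (map_mx Num.conj A)^T.

Definition psd {C : numClosedFieldType} {d : nat} (A : 'M[C]_d) : Prop :=
  adjmx A = A /\ forall v : 'cV[C]_d, 0 <= (adjmx v *m A *m v) 0 0.

Definition is_POVM {C : numClosedFieldType} {d K : nat}
  (M : 'I_K -> 'M[C]_d) : Prop :=
  (forall a, psd (M a)) /\ \sum_(a < K) M a = 1%:M.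

(** A bipartite (NA,NB)-input strategy in which every measurement has K
    outcomes.  H_A = C^dA, H_B = C^dB, H_A (x) H_B = C^(dA*dB) via the
    Kronecker product (index mxtens_index (i,j) <-> |i>|j>). *)
Record strategy (C : numClosedFieldType) (NA NB K : nat) := Strategy {
  dimA : nat;
  dimB : nat;
  state : 'cV[C]_(dimA * dimB);
  measA : 'I_NA -> 'I_K -> 'M[C]_dimA;
  measB : 'I_NB -> 'I_K -> 'M[C]_dimB }.

Arguments dimA {C NA NB K}.
Arguments dimB {C NA NB K}.
Arguments state {C NA NB K}.
Arguments measA {C NA NB K}.
Arguments measB {C NA NB K}.

Definition valid_strategy {C : numClosedFieldType} {NA NB K : nat}
  (S : strategy C NA NB K) : Prop :=
  adjmx (state S) *m state S = 1%:M /\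
  (forall i, is_POVM (measA S i)) /\ (forall j, is_POVM (measB S j)).

Definition correlation {C : numClosedFieldType} {NA NB K : nat}
  (S : strategy C NA NB K) (i : 'I_NA) (j : 'I_NB) (a b : 'I_K) : C :=
  (adjmx (state S) *m (measA S i a *t measB S j b) *m state S) 0 0.

(** St is a local dilation of S.  The vector
    (U_A (x) U_B)(M_{i,a} (x) N_{j,b})|psi> lives in
    (C^dA~ (x) C^kA) (x) (C^dB~ (x) C^kB), the vector
    (M~ (x) N~)|psi~> (x) |aux> in (C^dA~ (x) C^dB~) (x) (C^kA (x) C^kB);
    they are compared through the canonical identification
    |x>|k>|y>|l>  <->  |x>|y>|k>|l>. *)
Definition local_dilation {C : numClosedFieldType} {NA NB K : nat}
  (St S : strategy C NA NB K) : Prop :=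
  exists (kA kB : nat) (aux : 'cV[C]_(kA * kB))
         (UA : 'M[C]_(dimA St * kA, dimA S))
         (UB : 'M[C]_(dimB St * kB, dimB S)),
    [/\ adjmx aux *m aux = 1%:M,
        adjmx UA *m UA = 1%:M,
        adjmx UB *m UB = 1%:M &
        forall (i : 'I_NA) (j : 'I_NB) (a b : 'I_K)
               (x : 'I_(dimA St)) (k : 'I_kA) (y : 'I_(dimB St)) (l : 'I_kB),
          ((UA *t UB) *m (measA S i a *t measB S j b) *m state S)
            (mxtens_index (mxtens_index (x, k), mxtens_index (y, l))) 0
          = (((measA St i a *t measB St j b) *m state St) *t aux)
            (mxtens_index (mxtens_index (x, y), mxtens_index (k, l)))
            (mxtens_index (ord0, ord0))].

Definition self_tested {C : numClosedFieldType} {NA NB K : nat}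
  (St : strategy C NA NB K) : Prop :=
  forall S : strategy C NA NB K, valid_strategy S ->
    (forall i j a b, correlation S i j a b = correlation St i j a b) ->
    local_dilation St S.

Definition RtoC {R : realType} (x : R) : R[i] := Complex x 0.
Definition cmx {R : realType} {m n : nat} (A : 'M[R]_(m, n)) : 'M[R[i]]_(m, n) :=
  map_mx RtoC A.

Definition phi_state {C : numClosedFieldType} (n : nat) : 'cV[C]_(n * n) :=
  \col_k (if (mxtens_unindex k).1 == (mxtens_unindex k).2
          then (sqrtC (n%:R : C))^-1 else 0).

Definition proj_meas {R : realType} {n : nat} (P : 'I_4 -> 'M[R]_n)
  (i : 'I_4) (a : 'I_2) : 'M[R[i]]_n :=
  if a == ord0 then cmx (P i) else 1%:M - cmx (P i).

Definition S_strategy {R : realType} (n : nat) (P : 'I_4 -> 'M[R]_n)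
  : strategy R[i] 4 4 2 :=
  @Strategy R[i] 4 4 2 n n (phi_state n) (proj_meas P) (proj_meas P).

Definition frak_P_quadruple {R : realType} (n : nat) (P : 'I_4 -> 'M[R]_n)
  : Prop :=
  [/\ (forall i, (P i)^T = P i /\ P i *m P i = P i),
      \sum_(i < 4) P i = (2 - (n%:R)^-1)%:M,
      ((\rank (P ord0))%:Z = (n./2)%:Z - (-1) ^+ n)
        /\ (forall i : 'I_4, i != ord0 -> \rank (P i) = n./2) &
      (forall U : 'M[R[i]]_n,
         (forall i, (U *m (cmx (P i))^T <= U)%MS) ->
         \rank U = 0%N \/ \rank U = n)].

(* Main.v *)
Require Import Defs.
From HB Require Import structures.
From mathcomp Require Import all_boot all_order all_algebra.
From mathcomp Require Import spectral.
From mathcomp Require Import reals.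
From mathcomp.real_closed Require Import complex mxtens.
From mathcomp Require Import zify ring.

(** Write [Psi] for the matrix of the state, so that [(A (x) B) psi] becomes
    [A Psi B^T].  Perfect correlation at equal settings gives
    [M_i Psi = Psi N_i^T] and [M_i^2 Psi = M_i Psi]; the vanishing expectation of
    [(sum_i M_i - alpha) (x) (sum_j N_j - alpha)], with [alpha = 2 - 1/n], gives
    [(sum_i M_i) Psi = alpha Psi].  Hence the [M_i], compressed to the range of
    [Psi], are four projections [Q_i] with sum [alpha], and [Psi Psi^*] defines a
    faithful trace [tau] on the algebra they generate.

    Put [X = Q_1 + Q_2 - 1], [Y = Q_1 - Q_2], [Z = Q_3 + Q_4 - 1],
    [W = Q_3 - Q_4].  Then [X + Z = -1/n], [XY = -YX], [X^2 + Y^2 = 1] and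
    likewise for [Z, W]: on the spectrum of [X] the operators [Y] and [W] act as
    the reflections [x -> -x] and [x -> -x - 2/n].  Let [n] be even.  Off
    [ker Y = ker (X + 1)] the operator [Y] is invertible and anticommutes with [X],
    so [- tau X = 1/n] is the mass of that kernel.  Climbing from the kernel
    by applying [W], [Y], [W], ... yields [n] mutually orthogonal eigenspaces of
    [X], each of mass [1/n], so they exhaust the space, and [tau Y] fixes the sign
    by which the ladder folds back at its top rung.  For odd [n] the two pairs
    exchange their roles.  So the [Q_i] are, up to a multiplicity space, given by
    matrices depending on [n] only; this applies to the ideal quadruple too, and
    matching the two ladders gives the local isometries.  The state that they
    produce commutes with the ideal quadruple, so by irreducibility it is
    maximally entangled tensor an auxiliary state. *)

Set Implicit Arguments.
Unset Strict Implicit.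
Unset Printing Implicit Defensive.
Import Order.TTheory GRing.Theory Num.Theory.
Local Open Scope ring_scope.

Local Notation "A ^H" := (adjmx A) (format "A ^H").

(** * Adjoints, the Hilbert-Schmidt norm, orthonormal bases and positive factorizations *)

Section Adjoint.
Context {C : numClosedFieldType}.

Lemma adjmxE m n (A : 'M[C]_(m, n)) i j : A^H i j = Num.conj (A j i).
Proof. by rewrite !mxE. Qed.

Lemma adjmxK m n (A : 'M[C]_(m, n)) : A^H^H = A.
Proof. by apply/matrixP=> i j; rewrite !mxE conjCK. Qed.

Lemma adjmxM m n p (A : 'M[C]_(m, n)) (B : 'M[C]_(n, p)) :
  (A *m B)^H = B^H *m A^H.
Proof. by rewrite /adjmx map_mxM trmx_mul. Qed.

Lemma adjmxD m n (A B : 'M[C]_(m, n)) : (A + B)^H = A^H + B^H.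
Proof. by rewrite /adjmx map_mxD linearD. Qed.

Lemma adjmxN m n (A : 'M[C]_(m, n)) : (- A)^H = - A^H.
Proof. by rewrite /adjmx map_mxN linearN. Qed.

Lemma adjmxB m n (A B : 'M[C]_(m, n)) : (A - B)^H = A^H - B^H.
Proof. by rewrite adjmxD adjmxN. Qed.

Lemma adjmxZ m n a (A : 'M[C]_(m, n)) : (a *: A)^H = a^* *: A^H.
Proof. by rewrite /adjmx map_mxZ linearZ. Qed.

Lemma adjmx0 m n : (0 : 'M[C]_(m, n))^H = 0.
Proof. by rewrite /adjmx map_mx0 trmx0. Qed.

Lemma adj_scalar_mx n a : (a%:M : 'M[C]_n)^H = (a^*)%:M.
Proof. by rewrite /adjmx map_scalar_mx tr_scalar_mx. Qed.

Lemma adjmx1 n : (1%:M : 'M[C]_n)^H = 1%:M.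
Proof. by rewrite adj_scalar_mx rmorph1. Qed.

Lemma adjmx_sum m n I (r : seq I) (P : pred I) (F : I -> 'M[C]_(m, n)) :
  (\sum_(i <- r | P i) F i)^H = \sum_(i <- r | P i) (F i)^H.
Proof. by apply: (big_morph (@adjmx C m n) (@adjmxD m n) (adjmx0 m n)). Qed.

Lemma adjmx_tr m n (A : 'M[C]_(m, n)) : A^T^H = A^H^T.
Proof. by apply/matrixP=> i j; rewrite !mxE. Qed.

Lemma trmxC_adj m n (A : 'M[C]_(m, n)) : map_mx Num.conj A^T = A^H.
Proof. by apply/matrixP=> i j; rewrite !mxE. Qed.

Lemma mxtraceN n (A : 'M[C]_n) : \tr (- A) = - \tr A.
Proof. exact: linearN. Qed.

Lemma mxtraceB n (A B : 'M[C]_n) : \tr (A - B) = \tr A - \tr B.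
Proof. exact: linearB. Qed.

Lemma mxtrace_sum n I (r : seq I) (P : pred I) (F : I -> 'M[C]_n) :
  \tr (\sum_(i <- r | P i) F i) = \sum_(i <- r | P i) \tr (F i).
Proof. exact: linear_sum. Qed.

Lemma mxtrace_adjmul m n (A : 'M[C]_(m, n)) :
  \tr (A^H *m A) = \sum_j \sum_i `|A i j| ^+ 2.
Proof.
apply: eq_bigr=> j _; rewrite mxE; apply: eq_bigr=> i _.
by rewrite adjmxE normCK mulrC.
Qed.

Lemma mxtrace_adjmul_ge0 m n (A : 'M[C]_(m, n)) : 0 <= \tr (A^H *m A).
Proof. by rewrite mxtrace_adjmul !sumr_ge0 // => j _; rewrite sumr_ge0 // => i _; rewrite exprn_ge0. Qed.

Lemma mxtrace_adjmul_eq0 m n (A : 'M[C]_(m, n)) : \tr (A^H *m A) = 0 -> A = 0.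
Proof.
have ge0 i j : 0 <= `|A i j| ^+ 2 by rewrite exprn_ge0.
rewrite mxtrace_adjmul => /eqP; rewrite psumr_eq0 => [/allP A0|j _]; last by rewrite sumr_ge0.
apply/matrixP=> i j; rewrite mxE; have := A0 j (mem_index_enum j).
rewrite /= psumr_eq0 // => /allP /(_ i (mem_index_enum i)).
by rewrite /= expf_eq0 /= normr_eq0 => /eqP.
Qed.

(** Gram-Schmidt on a row basis of [A^T]. The matrix [D] is recorded because it is a right inverse
    of [V^H *m A], which later allows cancelling the compressed state. *)
Lemma orthonormal_colspan d m (A : 'M[C]_(d, m)) :
  exists r (V : 'M[C]_(d, r)) (D : 'M[C]_(m, r)),
    [/\ V^H *m V = 1%:M, V = A *m D & V *m V^H *m A = A].
Proof.
set S := schmidt (row_base A^T).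
have Su : S \is unitarymx by rewrite schmidt_unitarymx // rank_leq_col.
have SE : (S :=: A^T)%MS.
  by apply: eqmx_trans (eq_row_base _); apply: eqmx_schmidt_free; exact: row_base_free.
have [D SD] : exists D, S = D *m A^T by apply/submxP; rewrite SE.
have [E AE] : exists E, A^T = E *m S by apply/submxP; rewrite SE.
have VV : S^T^H *m S^T = 1%:M.
  by rewrite adjmx_tr -trmx_mul -trmxC_adj (unitarymxP Su) trmx1.
have AE' : A = S^T *m E^T by rewrite -trmx_mul -AE trmxK.
exists _, S^T, D^T; split => //; first by rewrite SD trmx_mul trmxK.
have : S^T *m S^T^H *m (S^T *m E^T) = S^T *m E^T.
  by rewrite mulmxA -[_ *m _ *m S^T]mulmxA VV mulmx1.
by rewrite -AE'.
Qed.

Lemma orthonormal_kernel d (A : 'M[C]_d) :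
  exists k (F : 'M[C]_(d, k)),
    [/\ F^H *m F = 1%:M, A *m F = 0 &
        forall m (v : 'M[C]_(d, m)), A *m v = 0 -> F *m F^H *m v = v].
Proof.
have [k [F [D [F1 FD FA]]]] := orthonormal_colspan (kermx A^T)^T.
exists k, F; split => // [|m v Av].
  by rewrite FD mulmxA -{1}[A]trmxK -trmx_mul mulmx_ker trmx0 mul0mx.
have : (v^T <= kermx A^T)%MS by apply/sub_kermxP; rewrite -trmx_mul Av trmx0.
case/submxP=> E /(congr1 trmx); rewrite trmxK trmx_mul => ->.
by rewrite mulmxA FA.
Qed.

(** Diagonalize and take square roots of the eigenvalues, which are values of the quadratic form at
    eigenvectors and hence nonnegative. *)
Lemma psd_factor d (A : 'M[C]_d) : psd A -> exists B : 'M[C]_d, A = B^H *m B.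
Proof.
move=> [Ah Apos].
have /hermitian_normalmx /orthomx_spectralP : A \is hermsymmx.
  by apply/is_hermitianmxP; rewrite expr0 scale1r trmxC_adj.
set P := spectralmx A; set D := spectral_diag A => AE.
have Pu : P \is unitarymx by exact: spectral_unitarymx.
have PP : P *m P^H = 1%:M by rewrite -trmxC_adj; exact/unitarymxP.
rewrite invmx_unitary // trmxC_adj in AE.
have D0 i : 0 <= D 0 i.
  have := Apos (P^H *m delta_mx i 0).
  rewrite adjmxM adjmxK {1}AE.
  rewrite !mulmxA -[_ *m P *m P^H]mulmxA PP mulmx1.
  rewrite -[_ *m P *m P^H]mulmxA PP mulmx1.
  suff -> : (delta_mx i 0 : 'cV[C]_d)^H = delta_mx 0 i.
    by rewrite -rowE -colE !mxE eqxx mulr1n.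
  by rewrite /adjmx map_delta_mx trmx_delta.
exists (diag_mx (map_mx sqrtC D) *m P).
rewrite adjmxM mulmxA -[_ *m _ *m diag_mx _]mulmxA {1}AE; congr (_ *m _ *m _).
rewrite /adjmx map_diag_mx tr_diag_mx mulmx_diag; congr diag_mx.
apply/rowP=> i; rewrite !mxE /= conj_Creal ?ger0_real ?sqrtC_ge0 //.
by rewrite -expr2 sqrtCK.
Qed.

(** With [M = B^H *m B] and [N = D^H *m D], the trace is the squared Hilbert-Schmidt norm of
    [B *m Psi *m D^T]. *)
Lemma psd_mul_eq0 dA dB (M : 'M[C]_dA) (N : 'M[C]_dB) (Psi : 'M[C]_(dA, dB)) :
  psd M -> psd N -> \tr (Psi^H *m M *m Psi *m N^T) = 0 -> M *m Psi *m N^T = 0.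
Proof.
move=> /psd_factor[B ->] /psd_factor[D ->] h.
have : B *m Psi *m D^T = 0.
  apply: mxtrace_adjmul_eq0; rewrite -{}h !adjmxM trmx_mul.
  by rewrite adjmx_tr -!mulmxA mxtrace_mulC !mulmxA.
by move=> h0; rewrite trmx_mul !mulmxA -[_ *m B *m _]mulmxA -[_ *m _ *m D^T]mulmxA h0 mulmx0 mul0mx.
Qed.
End Adjoint.

(** * Weights and rungs of the ladder, and the mass of its bottom kernel *)

Section Ladder.
Context {C : numClosedFieldType}.

(** Where [A b] has eigenvalue c, the relation of squares makes [B b] stretch by sqrt(1 - c^2). Here
    c = 1 - (j+1)/n is the eigenvalue of [A (odd j.+1)] on rung [j]. *)
Definition weight n j : C := sqrtC (1 - (1 - j.+1%:R / n%:R) ^+ 2).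

Lemma weight2_gt0 n j : (j < n)%N -> 0 < 1 - (1 - j.+1%:R / n%:R) ^+ 2 :> C.
Proof.
move=> jn; have n0 : 0 < n%:R :> C by rewrite ltr0n (leq_ltn_trans _ jn).
set t := _ / _; have t0 : 0 < t by apply: divr_gt0 => //; rewrite ltr0n.
have t1 : t <= 1 by rewrite /t ler_pdivrMr // mul1r ler_nat.
have -> : 1 - (1 - t) ^+ 2 = t * (2 - t) by ring.
by rewrite mulr_gt0 // subr_gt0 (le_lt_trans t1) // ltr1n.
Qed.

Lemma weight_gt0 n j : (j < n)%N -> 0 < weight n j.
Proof. by move=> jn; rewrite sqrtC_gt0 weight2_gt0. Qed.

Lemma weight_conj n j : (j < n)%N -> (weight n j)^* = weight n j.
Proof. by move=> jn; rewrite conj_Creal // gtr0_real // weight_gt0. Qed.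

Lemma weight_last n : (0 < n)%N -> weight n n.-1 = 1.
Proof.
move=> n0; rewrite /weight prednK // divff ?pnatr_eq0 -?lt0n //.
by rewrite subrr expr0n subr0 sqrtC1.
Qed.

(** [(A b, B b)] will be [(X, Y)] for [b = odd n] and [(Z, W)] otherwise: for
    either parity the ladder then starts in [ker (B false)] and folds back under
    [B (odd n)]. *)
Record ladder_rep n r (A B : bool -> 'M[C]_r) (rho : 'M[C]_r) (eps : C) : Prop :=
  LadderRep {
  ladder_Ah : forall b, (A b)^H = A b;
  ladder_Bh : forall b, (B b)^H = B b;
  ladder_AB : forall b, A b *m B b = - (B b *m A b);
  ladder_sq : forall b, A b *m A b + B b *m B b = 1%:M;
  ladder_sum : A false + A true = (- n%:R^-1)%:M;
  ladder_rhoA : forall b, rho *m A b = A b *m rho;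
  ladder_rhoB : forall b, rho *m B b = B b *m rho;
  ladder_rho_faithful : forall k (G : 'M[C]_(r, k)), \tr (rho *m (G *m G^H)) = 0 -> G = 0;
  ladder_trrho : \tr rho = 1;
  ladder_trA : \tr (rho *m A false) = - n%:R^-1;
  ladder_trB : \tr (rho *m B (odd n)) = eps / n%:R;
  ladder_eps2 : eps * eps = 1;
  ladder_epsC : eps^* = eps }.

(** The eigenvalue of [A false] on rung [j]. Each rung carries one eigenvalue for [A (odd j)] and
    one for [A (odd j.+1)]; the parity of [j] decides which of the two belongs to [A false]. *)
Definition rung n j : C :=
  if odd j then 1 - j.+1%:R / n%:R else - (1 - j%:R / n%:R).

(** Odd rungs have nonnegative values and even rungs negative ones, and within one parity the value
    is strictly monotone in the index. *)
Lemma rung_inj n i j : (i < n)%N -> (j < n)%N -> rung n i = rung n j -> i = j.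
Proof.
move=> ltin ltjn.
have n0 : n%:R != 0 :> C by rewrite pnatr_eq0 -lt0n (leq_ltn_trans _ ltin).
have nV0 : n%:R^-1 != 0 :> C by rewrite invr_eq0.
have key a b : (a <= n)%N -> (b < n)%N -> 1 - a%:R / n%:R <> - (1 - b%:R / n%:R) :> C.
  move=> an bn h; have : (a%:R + b%:R) = n%:R + n%:R :> C.
    have e : a%:R / n%:R + b%:R / n%:R = 1 + 1
        - ((1 - a%:R / n%:R) + (1 - b%:R / n%:R)) :> C by ring.
    by apply: (mulIf nV0); rewrite !mulrDl divff // e h addNr subr0.
  rewrite -!natrD => /eqP; rewrite eqr_nat => /eqP; lia.
rewrite /rung; case: ifP => oi; case: ifP => oj h.
- move/(addrI _)/oppr_inj/(mulIf nV0)/eqP: h; rewrite eqr_nat => /eqP; lia.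
- by case: (key i.+1 j).
- by case: (key j.+1 i).
- move/oppr_inj/(addrI _)/oppr_inj/(mulIf nV0)/eqP: h; rewrite eqr_nat => /eqP; lia.
Qed.

(** For [j < n], [F j] embeds the multiplicity space C^k as rung [j]. [F n] is not a further rung:
    by [lb_top] it is the top rung up to [eps], so [lb_up] at [n.-1] encodes the fold. *)
Record ladder_basis n r k (A B : bool -> 'M[C]_r) (eps : C)
  (F : nat -> 'M[C]_(r, k)) : Prop := LadderBasis {
  lb_ortho : forall i j, (i < n)%N -> (j < n)%N ->
    (F i)^H *m F j = (i == j)%:R%:M;
  lb_complete : \sum_(j < n) F j *m (F j)^H = 1%:M;
  lb_A : forall j, (j < n)%N -> A false *m F j = rung n j *: F j;
  lb_up : forall j, (j < n)%N -> B (odd j.+1) *m F j = weight n j *: F j.+1;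
  lb_down : forall j, (j < n)%N -> B (odd j.+1) *m F j.+1 = weight n j *: F j;
  lb_bottom : B false *m F 0 = 0;
  lb_top : F n = eps *: F n.-1 }.

Section Kernel.
Context (n r : nat) (A B : bool -> 'M[C]_r) (rho : 'M[C]_r) (eps : C).
Hypothesis (n_gt0 : (0 < n)%N) (L : ladder_rep n A B rho eps).

Let nR_neq0 : n%:R != 0 :> C.
Proof. by rewrite pnatr_eq0 -lt0n. Qed.

Lemma trace_swap (X Y : 'M[C]_r) : rho *m X = X *m rho ->
  \tr (rho *m (X *m Y)) = \tr (rho *m (Y *m X)).
Proof. by move=> h; rewrite mulmxA h -mulmxA mxtrace_mulC -mulmxA. Qed.

Lemma ladder_sumb b : A (~~ b) = (- n%:R^-1)%:M - A b.
Proof.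
have := ladder_sum L; case: b => /= <-; last by rewrite addrC addKr.
by rewrite addrK.
Qed.

(** On this kernel [A false] squares to 1. The eigenvalue +1, whose part is [G], is excluded: there
    [A true] would be -(1 + 1/n), and the square of the self-adjoint [B true] would be negative. *)
Lemma ker_B0 k (F : 'M[C]_(r, k)) : B false *m F = 0 -> A false *m F = - F.
Proof.
move=> BF.
have AAF : A false *m (A false *m F) = F.
  have := ladder_sq L false; move/(congr1 (mulmx^~ F)).
  by rewrite mulmxDl mul1mx -!mulmxA BF mulmx0 addr0.
pose G := F + A false *m F.
have AG : A false *m G = G by rewrite mulmxDr AAF addrC.
have A1G : A true *m G = (- (1 + n%:R^-1)) *: G.
  by rewrite (ladder_sumb false) mulmxBl AG mul_scalar_mx [in RHS]opprD [RHS]scalerDl scaleN1r addrC.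
have BBG : B true *m (B true *m G) = (1 - (1 + n%:R^-1) ^+ 2) *: G.
  have := ladder_sq L true; move/(congr1 (mulmx^~ G)).
  rewrite mulmxDl mul1mx -!mulmxA A1G -scalemxAr A1G scalerA => h.
  by rewrite scalerBl scale1r -{2}h addrC expr2 mulrNN addKr.
have c0 : 1 - (1 + n%:R^-1) ^+ 2 < 0 :> C.
  have i0 : 0 < n%:R^-1 :> C by rewrite invr_gt0 ltr0n.
  have -> : 1 - (1 + n%:R^-1) ^+ 2 = - (n%:R^-1 * (2 + n%:R^-1)) :> C by ring.
  by rewrite oppr_lt0 mulr_gt0 // addr_gt0.
have G0 : G = 0.
  apply: mxtrace_adjmul_eq0; apply/eqP; rewrite eq_le mxtrace_adjmul_ge0 andbT.
  have := mxtrace_adjmul_ge0 (B true *m G).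
  rewrite adjmxM (ladder_Bh L) -mulmxA BBG -scalemxAr mxtraceZ.
  by rewrite nmulr_rge0.
by move/eqP: G0; rewrite /G addrC addr_eq0 => /eqP.
Qed.

Lemma trace_ker_B0 k (F : 'M[C]_(r, k)) :
  F^H *m F = 1%:M -> B false *m F = 0 ->
  (forall m (v : 'M[C]_(r, m)), B false *m v = 0 -> F *m F^H *m v = v) ->
  \tr (rho *m (F *m F^H)) = n%:R^-1.
Proof.
move=> F1 BF Fker; have AF := ker_B0 BF.
pose E := F *m F^H; pose a := A false; pose b := B false.
have Eh : E^H = E by rewrite adjmxM adjmxK.
have EE : E *m E = E by rewrite /E mulmxA -[_ *m _ *m F]mulmxA F1 mulmx1.
have bE : b *m E = 0 by rewrite mulmxA BF mul0mx.
have Eb : E *m b = 0.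
  by rewrite -[E *m b]adjmxK adjmxM Eh (ladder_Bh L) bE adjmx0.
have aE : a *m E = - E by rewrite mulmxA AF mulNmx.
have Ea : E *m a = - E by rewrite -[E *m a]adjmxK adjmxM Eh (ladder_Ah L) aE adjmxN Eh.
have ab : a *m b = - (b *m a) := ladder_AB L false.
(* Adding the kernel projection makes [b *m b] invertible. The inverse [g] still commutes with [b],
   and [b *m b *m g] is the projection off the kernel. *)
pose h := b *m b + E.
have hU : h \in unitmx.
  rewrite -row_free_unit; apply: inj_row_free => v vh.
  have vE : v *m E = 0.
    have := congr1 (mulmx^~ E) vh; rewrite mul0mx -mulmxA mulmxDl.
    by rewrite -mulmxA bE mulmx0 add0r EE.
  have vbb : v *m b *m b = 0.
    by move: vh; rewrite mulmxDr vE addr0 mulmxA.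
  have bv : b *m v^H = 0.
    apply: mxtrace_adjmul_eq0; rewrite adjmxM adjmxK (ladder_Bh L).
    by rewrite mulmxA vbb mul0mx mxtrace0.
  by have := congr1 adjmx (Fker _ _ bv); rewrite -/E adjmxM adjmxK Eh vE.
have ha : h *m a = a *m h.
  rewrite mulmxDl mulmxDr aE Ea; congr (_ + _).
  by rewrite mulmxA ab mulNmx -[b *m a *m b]mulmxA ab mulmxN opprK mulmxA.
have hb : h *m b = b *m h by rewrite mulmxDl mulmxDr bE Eb !addr0 mulmxA.
pose g := invmx h.
have gb : g *m b = b *m g.
  by rewrite -[RHS]mul1mx -(mulVmx hU) -!mulmxA (mulmxA h) hb -mulmxA mulmxV // mulmx1.
have bbg : b *m b *m g = 1%:M - E.
  have Eh' : E *m h = E by rewrite mulmxDr mulmxA Eb mul0mx add0r EE.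
  have Eg : E *m g = E by rewrite -{1}Eh' -mulmxA mulmxV // mulmx1.
  by rewrite -Eg -(mulmxV hU) -mulmxBl /h addrK.
(* Write [1%:M - E] as [b *m b *m g]: cycling one [b] around the trace and anticommuting it past [a]
   reverses the sign. *)
have t0 : \tr (rho *m (a *m (1%:M - E))) = 0.
  have e : \tr (rho *m (a *m (1%:M - E))) = - \tr (rho *m (a *m (1%:M - E))).
    have e1 : a *m (b *m b *m g) = a *m b *m g *m b.
      by rewrite -(mulmxA _ g) gb !mulmxA.
    have e2 : b *m (a *m b *m g) = - (a *m (b *m b *m g)).
      by rewrite !mulmxA -[b *m a]opprK -ab !mulNmx.
    by rewrite -bbg {1}e1 -trace_swap ?(ladder_rhoB L) // e2 mulmxN mxtraceN.
  have := addrN (\tr (rho *m (a *m (1%:M - E)))); rewrite {2}e opprK -mulr2n.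
  by move/eqP; rewrite mulrn_eq0 => /eqP.
have := ladder_trA L; rewrite -[A false]mulmx1 -(subrK E 1%:M) mulmxDr mulmxDr.
by rewrite mxtraceD t0 add0r aE mulmxN mxtraceN => /oppr_inj.
Qed.
End Kernel.
End Ladder.

(** * Climbing from the kernel: orthogonality, completeness and the fold at the top *)

Section Ladder.
Context {C : numClosedFieldType}.
Section Climb.
Context (n r : nat) (A B : bool -> 'M[C]_r) (rho : 'M[C]_r) (eps : C).
Hypothesis (n_gt0 : (0 < n)%N) (L : ladder_rep n A B rho eps).

Let nR_neq0 : n%:R != 0 :> C.
Proof. by rewrite pnatr_eq0 -lt0n. Qed.

Fixpoint climb k (F0 : 'M[C]_(r, k)) j :=
  if j is i.+1 then (weight n i)^-1 *: (B (odd j) *m climb F0 i) else F0.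

Context (k : nat) (F0 : 'M[C]_(r, k)).
Hypothesis (F0_iso : F0^H *m F0 = 1%:M) (BF0 : B false *m F0 = 0).
Hypothesis tr_F0 : \tr (rho *m (F0 *m F0^H)) = n%:R^-1.
Let F := climb F0.

Lemma climb_up j : (j < n)%N -> B (odd j.+1) *m F j = weight n j *: F j.+1.
Proof. by move=> jn; rewrite /F /= scalerA mulfV ?gt_eqF ?weight_gt0 // scale1r. Qed.

(** Two alternating moves: on a fixed rung, the sum relation turns the eigenvalue of one [A] into
    that of the other; from rung [j] to [j.+1], anticommutation with [B (odd j.+1)] negates the
    eigenvalue of [A (odd j.+1)]. *)
Lemma climb_eigen j : (j < n)%N ->
  A (odd j) *m F j = - (1 - j%:R / n%:R) *: F j /\
  A (odd j.+1) *m F j = (1 - j.+1%:R / n%:R) *: F j.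
Proof.
have flip i c : A (odd i) *m F i = - c *: F i ->
    A (odd i.+1) *m F i = (c - n%:R^-1) *: F i.
  move=> h; rewrite oddS (ladder_sumb L) mulmxBl mul_scalar_mx h -scalerBl.
  by rewrite opprK addrC.
have two i c : c = 1 - i%:R / n%:R -> A (odd i) *m F i = - c *: F i ->
  A (odd i) *m F i = - (1 - i%:R / n%:R) *: F i /\
  A (odd i.+1) *m F i = (1 - i.+1%:R / n%:R) *: F i.
  move=> -> h; split => //; rewrite (flip _ _ h); congr (_ *: _).
  by rewrite -[i.+1%:R]natr1 mulrDl mul1r; ring.
elim: j => [_|j IH jn].
  by apply: (two 0%N 1); rewrite ?mul0r ?subr0 // scaleN1r (ker_B0 n_gt0 L).
have [_ h] := IH (ltnW jn).
apply: (two j.+1 (1 - j.+1%:R / n%:R)) => //.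
rewrite /F /= -/F -scalemxAr mulmxA (ladder_AB L) mulNmx -mulmxA h.
rewrite -scalemxAr scalerN !scalerA. 
by rewrite mulNr mulrC scaleNr.
Qed.

Lemma climb_A j : (j < n)%N -> A false *m F j = rung n j *: F j.
Proof.
move=> /climb_eigen[]; rewrite /rung oddS; case: (odd j) => //=.
Qed.

Lemma climb_BB j : (j < n)%N ->
  B (odd j.+1) *m (B (odd j.+1) *m F j) = weight n j ^+ 2 *: F j.
Proof.
move=> jn; have [_ h] := climb_eigen jn.
have := ladder_sq L (odd j.+1); move/(congr1 (mulmx^~ (F j))).
rewrite mulmxDl mul1mx -!mulmxA h -scalemxAr h scalerA => e.
by rewrite sqrtCK scalerBl scale1r -{2}e expr2 [in RHS]addrC addKr.
Qed.

Lemma climb_down j : (j < n)%N -> B (odd j.+1) *m F j.+1 = weight n j *: F j.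
Proof.
move=> jn; rewrite {1}/F /= -/F -scalemxAr climb_BB // scalerA expr2 mulrA.
by rewrite mulVf ?gt_eqF ?weight_gt0 // mul1r.
Qed.

Lemma climbS_adj j : (j < n)%N ->
  (F j.+1)^H = (weight n j)^-1 *: ((F j)^H *m B (odd j.+1)).
Proof.
by move=> jn; rewrite /F /= adjmxZ adjmxM (ladder_Bh L) fmorphV /= weight_conj.
Qed.

Lemma climb_iso j : (j <= n)%N -> (F j)^H *m F j = 1%:M.
Proof.
elim: j => [_|j IH jn]; first exact: F0_iso.
rewrite climbS_adj // -scalemxAl -mulmxA climb_down // -scalemxAr IH 1?ltnW //.
by rewrite scalerA mulVf ?gt_eqF ?weight_gt0 // scale1r.
Qed.

(** Cycling one factor [B] around the trace undoes the last step, so every rung inherits the mass of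
    the bottom one. *)
Lemma climb_trace j : (j <= n)%N -> \tr (rho *m (F j *m (F j)^H)) = n%:R^-1.
Proof.
elim: j => [_|j IH jn]; first exact: tr_F0.
rewrite climbS_adj // -scalemxAr mulmxA -scalemxAr mxtraceZ.
rewrite -trace_swap ?(ladder_rhoB L) // (mulmxA (B _)) climb_down // -scalemxAl.
rewrite -scalemxAr mxtraceZ mulrA mulVf ?gt_eqF ?weight_gt0 // mul1r.
by rewrite IH // ltnW.
Qed.

Lemma rung_conj i : (rung n i : C)^* = rung n i.
Proof.
by rewrite /rung; case: odd; rewrite ?rmorphN rmorphB rmorph1 /= fmorph_div /= !rmorph_nat.
Qed.

Lemma climb_ortho i j : (i < n)%N -> (j < n)%N ->
  (F i)^H *m F j = (i == j)%:R%:M.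
Proof.
move=> ltin ltjn; case: eqP => [-> /=|ij]; first by rewrite climb_iso // ltnW.
have e : rung n j *: ((F i)^H *m F j) = rung n i *: ((F i)^H *m F j).
  rewrite scalemxAr -climb_A // mulmxA -{1}(ladder_Ah L false) -adjmxM climb_A //.
  by rewrite adjmxZ rung_conj scalemxAl.
move/eqP: e; rewrite -subr_eq0 -scalerBl scaler_eq0 subr_eq0 => /orP[/eqP h|/eqP ->].
  by case: ij; rewrite (rung_inj ltjn ltin h).
by rewrite raddf0.
Qed.

(** The [n] orthogonal rungs of mass 1/n have total mass 1, so the complementary projection has mass
    0 and vanishes by faithfulness. *)
Lemma climb_complete : \sum_(j < n) F j *m (F j)^H = 1%:M.
Proof.
set z := \sum_(j < n) _.
have zh : z^H = z by rewrite adjmx_sum; apply: eq_bigr => j _; rewrite adjmxM adjmxK.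
have zF (j : 'I_n) : z *m F j = F j.
  rewrite mulmx_suml (bigD1 j) //= -mulmxA climb_iso ?mulmx1; last by rewrite ltnW.
  rewrite big1 ?addr0 // => i ij.
  have /negPf ij' : (i != j :> nat) := ij.
  by rewrite -mulmxA climb_ortho // ij' /= raddf0 mulmx0.
have zz : z *m z = z.
  by rewrite {2}/z mulmx_sumr; apply: eq_bigr => j _; rewrite mulmxA zF.
suff : 1%:M - z = 0 by move/eqP; rewrite subr_eq0 => /eqP.
apply: (ladder_rho_faithful L).
rewrite adjmxB adjmx1 zh [X in rho *m X]mulmxBr !mulmxBl zz !mul1mx mulmx1 subrr subr0.
rewrite mulmxBr mulmx1 mxtraceB /= (ladder_trrho L) mulmx_sumr mxtrace_sum /=.
rewrite (eq_bigr (fun=> n%:R^-1)) => [|j _]; last by rewrite climb_trace // ltnW.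
by rewrite sumr_const card_ord -[_ *+ _]mulr_natl mulfV ?subrr.
Qed.

Lemma climb_offdiag i j : (i < n)%N -> (j < n)%N -> i != j ->
  \tr (rho *m (F i *m (F j)^H)) = 0.
Proof.
move=> ltin ltjn ij.
have e : rung n i * \tr (rho *m (F i *m (F j)^H))
    = rung n j * \tr (rho *m (F i *m (F j)^H)).
  rewrite -mxtraceZ scalemxAr scalemxAl -climb_A // -mulmxA.
  rewrite trace_swap ?(ladder_rhoA L) // -mulmxA.
  rewrite -{1}(ladder_Ah L false) -adjmxM climb_A // adjmxZ rung_conj.
  by rewrite -!scalemxAr mxtraceZ.
move/eqP: e; rewrite -subr_eq0 -mulrBl mulf_eq0 subr_eq0 => /orP[/eqP h|/eqP //].
by case/eqP: ij; rewrite (rung_inj ltin ltjn h).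
Qed.

(** An equality case of Cauchy-Schwarz: [F n] and [F n.-1] both have mass 1/n and their overlap is
    [eps / n], so [F n - eps *: F n.-1] has mass 0. *)
Lemma climb_top : F n = eps *: F n.-1.
Proof.
have ltn1 : (n.-1 < n)%N by rewrite prednK.
have Fn : B (odd n) *m F n.-1 = F n.
  by have := climb_up ltn1; rewrite prednK // weight_last // scale1r.
have tr_top : \tr (rho *m (F n *m (F n.-1)^H)) = eps / n%:R.
  rewrite -(ladder_trB L) -[B (odd n)]mulmx1 -climb_complete !mulmx_sumr mxtrace_sum /=.
  rewrite (bigD1 (Ordinal ltn1)) //= big1 ?addr0 => [|j].
    by rewrite (mulmxA (B _)) Fn.
  move=> jn1; have {}jn1 : (j != n.-1 :> nat) := jn1.
  rewrite (mulmxA (B _)).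
  have jS : (j.+1 < n)%N by have := ltn_ord j; lia.
  have jn := ltnW jS.
  (* [B (odd n)] sends every rung below the top to a multiple of a different rung, so only the top
     rung contributes to its trace. *)
  suff [c [i [ltin ij ->]]] : exists c i, [/\ (i < n)%N, i != j & B (odd n) *m F j = c *: F i].
    by rewrite -scalemxAl -scalemxAr mxtraceZ climb_offdiag // mulr0.
  have [/eqP oj|oj] := boolP (odd n == odd j.+1).
    exists (weight n j), j.+1; rewrite oj climb_up //; split => //; lia.
  have {}oj : odd n = odd j by move: oj => /=; case: odd; case: odd.
  case: (j : nat) jn jS oj => [|i] jn iS oj.
    (* The bottom rung is annihilated; with coefficient 0, [n.-1] is merely some other index. *)
    exists 0, n.-1; rewrite oj /= BF0 scale0r; split => //; lia.
  exists (weight n i), i; rewrite oj climb_down; last by lia.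
  split => //; lia.
apply/eqP; rewrite -subr_eq0; apply/eqP; apply: (ladder_rho_faithful L).
rewrite adjmxB adjmxZ (ladder_epsC L) mulmxBr !mulmxBl -!(scalemxAl, scalemxAr).
rewrite scalerA (ladder_eps2 L) scale1r !mulmxBr !mxtraceB /= -!scalemxAr !mxtraceZ.
have -> : \tr (rho *m (F n.-1 *m (F n)^H)) = eps / n%:R.
  rewrite -tr_top -{1}Fn adjmxM (ladder_Bh L) (mulmxA (F n.-1)).
  by rewrite -trace_swap ?(ladder_rhoB L) // (mulmxA (B _)) Fn.
rewrite tr_top !climb_trace ?leq_pred // mulrA (ladder_eps2 L) mul1r.
by rewrite !subrr.
Qed.
End Climb.

Lemma ladder_basis_exists n r (A B : bool -> 'M[C]_r) rho eps :
  (0 < n)%N -> ladder_rep n A B rho eps ->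
  exists k (F : nat -> 'M[C]_(r, k)), ladder_basis n A B eps F.
Proof.
move=> n0 L; have [k [F0 [F1 BF Fker]]] := orthonormal_kernel (B false).
have tr0 := trace_ker_B0 n0 L F1 BF Fker.
exists k, (climb n B F0); split.
- by move=> i j ltin ltjn; apply: (climb_ortho n0 L).
- exact: (climb_complete n0 L).
- by move=> j jn; apply: (climb_A n0 L).
- by move=> j jn; apply: climb_up.
- by move=> j jn; apply: (climb_down n0 L).
- exact: BF.
- exact: (climb_top n0 L).
Qed.
End Ladder.

Local Notation "A ^H" := (adjmx A) (format "A ^H").

(** * The isometry matching two ladders *)

Section Intertwiner.
Context {C : numClosedFieldType}.

(** Taking the trace of the completeness relation gives n * k = n. *)
Lemma ladder_basis_mult1 n k (A B : bool -> 'M[C]_n) eps (f : nat -> 'M[C]_(n, k)) :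
  (0 < n)%N -> ladder_basis n A B eps f -> k = 1%N.
Proof.
move=> n0 L; have := congr1 mxtrace (lb_complete L).
rewrite mxtrace_sum mxtrace1 (eq_bigr (fun=> k%:R)) => [|j _]; last first.
  by rewrite mxtrace_mulC (lb_ortho L) // eqxx mxtrace1.
rewrite sumr_const card_ord -[_ *+ n]mulr_natr -natrM => /eqP; rewrite eqr_nat => /eqP h.
by move: h; nia.
Qed.

(** Shifting drops only the last summand, so the two sides differ by [u n.-1 - v n.-1]. This is the
    bookkeeping that exchanges up and down moves in [intertwined_B]. *)
Lemma sum_shift_swap (V : zmodType) (u v : nat -> V) n : (0 < n)%N ->
  u n.-1 = v n.-1 ->
  \sum_(j < n) (u j + (if (j : nat) is i.+1 then v i else 0)) =
  \sum_(j < n) (v j + (if (j : nat) is i.+1 then u i else 0)).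
Proof.
case: n => //= m _ uv; rewrite !big_split /=.
rewrite [X in _ + X]big_ord_recl [in X in _ = _ + X]big_ord_recl /= !add0r.
rewrite big_ord_recr [X in _ = X + _]big_ord_recr /= uv.
by rewrite addrAC [RHS]addrAC; congr (_ + _); rewrite addrC.
Qed.

(** The action of [B b] on rung [j]: down if [odd j == b], with value 0 at the bottom, and up
    otherwise. The formula is common to both ladders. *)
Definition ladder_action b p q (F : nat -> 'M[C]_(p, q)) n j : 'M[C]_(p, q) :=
  if odd j == b then (if j is i.+1 then weight n i *: F i else 0)
  else weight n j *: F j.+1.

Lemma ladder_actionE n r k (A B : bool -> 'M[C]_r) eps (F : nat -> 'M[C]_(r, k)) b j :
  ladder_basis n A B eps F -> (j < n)%N -> B b *m F j = ladder_action b F n j.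
Proof.
move=> L jn; rewrite /ladder_action; case: eqP => [<-|/eqP ojb]; last first.
  by rewrite -(lb_up L) // oddS; congr (B _ *m _); move: ojb; case: odd; case: b.
case: j jn => [_|j jn]; first exact: lb_bottom L.
by rewrite (lb_down L) // ltnW.
Qed.

Context (n r k : nat) (A' B' : bool -> 'M[C]_n) (A B : bool -> 'M[C]_r) (eps : C).
Context (f : nat -> 'cV[C]_n) (F : nat -> 'M[C]_(r, k)).
Hypothesis (n_gt0 : (0 < n)%N) (epsC : eps^* = eps).
Hypothesis (Lf : ladder_basis n A' B' eps f) (LF : ladder_basis n A B eps F).

(** [block x] is [(<x| (x) 1) U] for the isometry [U = sum_j f_j (x) F_j^*]. *)
Definition block (x : 'I_n) : 'M[C]_(k, r) := \sum_(j < n) f j x 0 *: (F j)^H.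

Lemma block_iso : \sum_x (block x)^H *m block x = 1%:M.
Proof.
rewrite -(lb_complete LF) /block.
rewrite (eq_bigr (fun x => \sum_(i < n) \sum_(j < n)
  (((f i)^H) 0 x * f j x 0) *: (F i *m (F j)^H))) => [|x _]; last first.
  rewrite adjmx_sum mulmx_suml; apply: eq_bigr => i _.
  rewrite mulmx_sumr; apply: eq_bigr => j _.
  by rewrite adjmxZ adjmxK -scalemxAl -scalemxAr scalerA adjmxE.
rewrite exchange_big; apply: eq_bigr => i _ /=; rewrite exchange_big /=.
have e (j : 'I_n) : \sum_(x < n) ((f i)^H 0 x * f j x 0) *: (F i *m (F j)^H) =
    (i == j)%:R *: (F i *m (F j)^H).
  rewrite -scaler_suml; congr (_ *: _); have := lb_ortho Lf (ltn_ord i) (ltn_ord j).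
  by move/matrixP/(_ 0 0); rewrite mxE => ->; rewrite !mxE eqxx mulr1n.
rewrite (eq_bigr _ (fun j _ => e j)) (bigD1 i) //= eqxx scale1r big1 ?addr0 // => j.
by rewrite eq_sym => /negPf ->; rewrite scale0r.
Qed.

(** The relation U T = (T' (x) 1) U, read block by block. *)
Definition intertwined (T' : 'M[C]_n) (T : 'M[C]_r) :=
  forall x, block x *m T = \sum_y T' x y *: block y.

Lemma intertwinedD S' S T' T : intertwined S' S -> intertwined T' T ->
  intertwined (S' + T') (S + T).
Proof.
move=> hS hT x; rewrite mulmxDr hS hT -big_split; apply: eq_bigr => y _ /=.
by rewrite mxE scalerDl.
Qed.

Lemma intertwinedZ c T' T : intertwined T' T -> intertwined (c *: T') (c *: T).
Proof.
move=> hT x; rewrite -scalemxAr hT scaler_sumr; apply: eq_bigr => y _.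
by rewrite mxE scalerA.
Qed.

Lemma intertwined_scalar c : intertwined c%:M c%:M.
Proof.
move=> x; rewrite mul_mx_scalar (bigD1 x) //= mxE eqxx mulr1n big1 ?addr0 // => y xy.
by rewrite mxE eq_sym (negPf xy) scale0r.
Qed.

Lemma intertwinedP (T' : 'M[C]_n) (T : 'M[C]_r) : T^H = T ->
  (forall x, \sum_(j < n) (T' *m f j) x 0 *: (F j)^H
             = \sum_(j < n) f j x 0 *: (T *m F j)^H) ->
  intertwined T' T.
Proof.
move=> Th h x; rewrite mulmx_suml.
rewrite (eq_bigr (fun j : 'I_n => f j x 0 *: (T *m F j)^H)) => [|j _]; last first.
  by rewrite adjmxM Th scalemxAl.
rewrite -h (eq_bigr (fun j : 'I_n => \sum_y (T' x y * f j y 0) *: (F j)^H)) => [|j _].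
  rewrite exchange_big; apply: eq_bigr => y _ /=.
  by rewrite scaler_sumr; apply: eq_bigr => j _; rewrite scalerA.
by rewrite mxE scaler_suml.
Qed.

Lemma intertwined_A : (A false)^H = A false -> intertwined (A' false) (A false).
Proof.
move=> Ah; apply: intertwinedP => // x; apply: eq_bigr => j _.
by rewrite (lb_A Lf) // (lb_A LF) // adjmxZ rung_conj mxE scalerA mulrC.
Qed.

(** An up move on the [f] side at [j] gives the same term as a down move on the [F] side at [j.+1],
    and conversely. Only the fold remains, where both ladders have weight 1 and the same real
    [eps]. *)
Lemma intertwined_B b : (B b)^H = B b -> intertwined (B' b) (B b).
Proof.
move=> Bh; apply: intertwinedP => // x.
pose up j := if odd j == b then 0 else weight n j *: (f j.+1 x 0 *: (F j)^H).
pose up' j := if odd j == b then 0 else weight n j *: (f j x 0 *: (F j.+1)^H).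
pose down (g : nat -> 'M[C]_(k, r)) j := if j is i.+1 then g i else 0.
have oddN i : (odd i.+1 == b) = ~~ (odd i == b) by rewrite oddS; case: odd; case: (b).
rewrite (eq_bigr (fun j : 'I_n => up j + down up' j)) => [|j _]; last first.
  rewrite (ladder_actionE b Lf) // /ladder_action /up.
  case: (j : nat) => [|i].
    by case: ifP => _; rewrite /= ?addr0 mxE ?scale0r // scalerA.
  rewrite /= /up' -[(~~ odd i == b)]/(odd i.+1 == b) oddN.
  by case: (odd i == b) => /=; rewrite ?add0r ?addr0 mxE -scalerA.
rewrite [RHS](eq_bigr (fun j : 'I_n => up' j + down up j)) => [|j _]; last first.
  rewrite (ladder_actionE b LF) // /ladder_action /up'.
  have jn := ltn_ord j; case: (j : nat) jn => [|i] jn.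
    case: ifP => _; rewrite /= ?addr0 ?adjmx0 ?scaler0 //.
    by rewrite adjmxZ weight_conj // !scalerA mulrC.
  rewrite /= /up -[(~~ odd i == b)]/(odd i.+1 == b) oddN.
  have lin := ltnW jn.
  case: (odd i == b) => /=; rewrite ?add0r ?addr0 adjmxZ weight_conj //;
    by rewrite !scalerA mulrC.
apply: (sum_shift_swap n_gt0); rewrite /up /up' prednK //; case: eqP => // _.
rewrite (lb_top Lf) (lb_top LF) weight_last // adjmxZ epsC mxE.
by rewrite !scale1r scalerA mulrC.
Qed.
End Intertwiner.

Local Notation "A ^H" := (adjmx A) (format "A ^H").

(** * From quadruples of projections to ladders and back *)

Section Quadruple.
Context {C : numClosedFieldType}.

(** The normalized trace of the ideal projection, read off from the prescribed ranks. *)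
Definition rank_ratio n (i : 'I_4) : C :=
  (n./2%:R - (if i == ord0 then (-1) ^+ n else 0)) / n%:R.

(** What the ideal quadruple, with [rho] = 1/n, shares with the compression of any strategy having
    the ideal correlation. The dimension [r] is left free. *)
Record quad_rep n r (Q : 'I_4 -> 'M[C]_r) (rho : 'M[C]_r) : Prop := QuadRep {
  quad_h : forall i, (Q i)^H = Q i;
  quad_idem : forall i, Q i *m Q i = Q i;
  quad_sum : \sum_(i < 4) Q i = (2 - n%:R^-1)%:M;
  quad_comm : forall i, rho *m Q i = Q i *m rho;
  quad_faithful : forall k (G : 'M[C]_(r, k)), \tr (rho *m (G *m G^H)) = 0 -> G = 0;
  quad_trrho : \tr rho = 1;
  quad_tr : forall i, \tr (rho *m Q i) = rank_ratio n i }.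

Definition quadA n r (Q : 'I_4 -> 'M[C]_r) b : 'M[C]_r :=
  if b == odd n then Q (inord 0) + Q (inord 1) - 1%:M
  else Q (inord 2) + Q (inord 3) - 1%:M.

Definition quadB n r (Q : 'I_4 -> 'M[C]_r) b : 'M[C]_r :=
  if b == odd n then Q (inord 0) - Q (inord 1) else Q (inord 2) - Q (inord 3).

Lemma two_projections r (p q : 'M[C]_r) : p *m p = p -> q *m q = q ->
  (p + q - 1%:M) *m (p - q) = - ((p - q) *m (p + q - 1%:M)) /\
  (p + q - 1%:M) *m (p + q - 1%:M) + (p - q) *m (p - q) = 1%:M.
Proof.
move=> pp qq; rewrite !(mulmxBl, mulmxBr, mulmxDl, mulmxDr) pp qq !mulmx1 !mul1mx.
by move: (p *m q) (q *m p) => u v; split; apply/matrixP => i j; rewrite !mxE; ring.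
Qed.

Lemma sum_I4 (V : zmodType) (F : 'I_4 -> V) :
  \sum_(i < 4) F i = F (inord 0) + F (inord 1) + (F (inord 2) + F (inord 3)).
Proof.
rewrite !big_ord_recl big_ord0 addr0 !addrA.
by do !congr (_ + _); congr F; apply/val_inj; rewrite /= inordK.
Qed.

(** The exceptional rank of the first projection fixes the fold sign: its normalized trace differs
    from that of the second by [- (-1) ^+ n / n]. For either parity the trace of [quadA n Q false]
    comes out as -1/n. *)
Lemma quad_ladder n r (Q : 'I_4 -> 'M[C]_r) rho : (0 < n)%N -> quad_rep n Q rho ->
  ladder_rep n (quadA n Q) (quadB n Q) rho (- (-1) ^+ n).
Proof.
move=> n0 q; have nR : n%:R != 0 :> C by rewrite pnatr_eq0 -lt0n.
have rhoB s t : rho *m (Q s - Q t) = (Q s - Q t) *m rho.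
  by rewrite mulmxBr mulmxBl !(quad_comm q).
have rhoA s t : rho *m (Q s + Q t - 1%:M) = (Q s + Q t - 1%:M) *m rho.
  by rewrite mulmxBr mulmxBl mulmxDl mulmxDr !(quad_comm q) mulmx1 mul1mx.
have trA s t : \tr (rho *m (Q s + Q t - 1%:M)) = rank_ratio n s + rank_ratio n t - 1.
  by rewrite mulmxBr mulmxDr mulmx1 mxtraceB mxtraceD !(quad_tr q) (quad_trrho q).
have in0 : inord 0 == ord0 :> 'I_4 by rewrite -val_eqE /= inordK.
have in1 : (inord 1 == ord0 :> 'I_4) = false by rewrite -val_eqE /= inordK.
have in2 : (inord 2 == ord0 :> 'I_4) = false by rewrite -val_eqE /= inordK.
have in3 : (inord 3 == ord0 :> 'I_4) = false by rewrite -val_eqE /= inordK.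
have tp s t := two_projections (quad_idem q s) (quad_idem q t).
have nE : n%:R = (odd n)%:R + 2 * n./2%:R :> C.
  by rewrite -{1}(odd_double_half n) natrD -mul2n natrM.
split.
- by move=> b; rewrite /quadA; case: ifP => _; rewrite adjmxB adjmxD !(quad_h q) adjmx1.
- by move=> b; rewrite /quadB; case: ifP => _; rewrite adjmxB !(quad_h q).
- by move=> b; rewrite /quadA /quadB; case: ifP => _; apply: (tp _ _).1.
- by move=> b; rewrite /quadA /quadB; case: ifP => _; apply: (tp _ _).2.
- have := quad_sum q; rewrite sum_I4 /quadA => e.
  have {}e : Q (inord 0) + Q (inord 1) - 1%:M + (Q (inord 2) + Q (inord 3) - 1%:M)
             = (- n%:R^-1)%:M.
    rewrite addrACA e.
    apply/matrixP => i j; rewrite !mxE.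
    by case: (i == j); rewrite ?mulr1n ?mulr0n; ring.
  by case: (odd n) => //=; rewrite addrC.
- by move=> b; rewrite /quadA; case: ifP.
- by move=> b; rewrite /quadB; case: ifP.
- exact: quad_faithful q.
- exact: quad_trrho q.
- rewrite /quadA; case: eqP => on; rewrite trA /rank_ratio ?in0 ?in1 ?in2 ?in3.
    have nE' : n%:R = 2 * n./2%:R :> C by rewrite nE -on add0r.
    rewrite -signr_odd -on expr0 nE'; rewrite nE' mulf_eq0 negb_or in nR.
    by case/andP: nR => _ h0; field.
  have on' : odd n = true by move: on; case: odd.
  have nE' : n%:R = 1 + 2 * n./2%:R :> C by rewrite nE on'.
  by rewrite nE' in nR *; field.
- rewrite /quadB eqxx mulmxBr mxtraceB !(quad_tr q) /rank_ratio in0 in1.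
  by field.
- by rewrite mulrNN -expr2 sqrr_sign.
- by rewrite rmorphN /= rmorph_sign.
Qed.

Lemma half_sum r (p q : 'M[C]_r) : p = 2^-1 *: ((p + q - 1%:M) + (p - q) + 1%:M).
Proof. by apply/matrixP => i j; rewrite !mxE; field. Qed.

Lemma half_diff r (p q : 'M[C]_r) : q = 2^-1 *: ((p + q - 1%:M) + -1 *: (p - q) + 1%:M).
Proof. by apply/matrixP => i j; rewrite !mxE; field. Qed.

Lemma quad_from_AB n r (Q : 'I_4 -> 'M[C]_r) b :
  let S := 2^-1 *: (quadA n Q b + quadB n Q b + 1%:M) in
  let D := 2^-1 *: (quadA n Q b + -1 *: quadB n Q b + 1%:M) in
  if b == odd n then Q (inord 0) = S /\ Q (inord 1) = D
  else Q (inord 2) = S /\ Q (inord 3) = D.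
Proof.
rewrite /= /quadA /quadB; case: (b == odd n); (split; [exact: half_sum | exact: half_diff]).
Qed.

(** Both ladders have the same weights, rungs and sign. [A true] is a scalar minus [A false], and
    each projection is an affine combination of one [quadA] and one [quadB], so intertwining passes
    to the projections. *)
Lemma quad_intertwiner n r (Q' : 'I_4 -> 'M[C]_n) rho' (Q : 'I_4 -> 'M[C]_r) rho :
  (0 < n)%N -> quad_rep n Q' rho' -> quad_rep n Q rho ->
  exists k (u : 'I_n -> 'M[C]_(k, r)),
    \sum_x (u x)^H *m u x = 1%:M /\
    forall i x, u x *m Q i = \sum_y Q' i x y *: u y.
Proof.
move=> n0 /(quad_ladder n0) q' /(quad_ladder n0) q.
have [k' [f Lf]] := ladder_basis_exists n0 q'.
have [k [F LF]] := ladder_basis_exists n0 q.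
have k1 := ladder_basis_mult1 n0 Lf; rewrite {k'}k1 in f Lf.
exists k, (block f F); split; first exact: block_iso Lf LF.
have itD := @intertwinedD _ _ _ _ f F; have itZ := @intertwinedZ _ _ _ _ f F.
have it1 := @intertwined_scalar _ _ _ _ f F.
have B b : intertwined f F (quadB n Q' b) (quadB n Q b).
  by apply: (intertwined_B n0 (ladder_epsC q) Lf LF); exact: ladder_Bh q b.
have A0 : intertwined f F (quadA n Q' false) (quadA n Q false).
  by apply: (intertwined_A Lf LF); exact: ladder_Ah q false.
have A b : intertwined f F (quadA n Q' b) (quadA n Q b).
  case: b => //; rewrite (ladder_sumb q' false) (ladder_sumb q false).
  by rewrite -!scaleN1r; apply: itD => //; exact: itZ.
have sum2 b : intertwined f F (2^-1 *: (quadA n Q' b + quadB n Q' b + 1%:M))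
                              (2^-1 *: (quadA n Q b + quadB n Q b + 1%:M)).
  by apply/itZ/itD; [exact/itD | exact: it1].
have diff2 b : intertwined f F (2^-1 *: (quadA n Q' b + -1 *: quadB n Q' b + 1%:M))
                               (2^-1 *: (quadA n Q b + -1 *: quadB n Q b + 1%:M)).
  by apply/itZ/itD; [apply/itD => //; exact/itZ | exact: it1].
have := (quad_from_AB n Q (odd n), quad_from_AB n Q' (odd n)); rewrite eqxx /=.
have := (quad_from_AB n Q (~~ odd n), quad_from_AB n Q' (~~ odd n)).
rewrite (negPf (_ : ~~ odd n != odd n)) /=; last by case: odd.
move=> [[Q2 Q3] [Q'2 Q'3]] [[Q0 Q1] [Q'0 Q'1]].
case=> [[|[|[|[|//]]]] i4].
- rewrite (_ : Ordinal i4 = inord 0) ?Q0 ?Q'0; first exact: sum2.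
  by apply/val_inj; rewrite /= inordK.
- rewrite (_ : Ordinal i4 = inord 1) ?Q1 ?Q'1; first exact: diff2.
  by apply/val_inj; rewrite /= inordK.
- rewrite (_ : Ordinal i4 = inord 2) ?Q2 ?Q'2; first exact: sum2.
  by apply/val_inj; rewrite /= inordK.
- rewrite (_ : Ordinal i4 = inord 3) ?Q3 ?Q'3; first exact: diff2.
  by apply/val_inj; rewrite /= inordK.
Qed.
End Quadruple.

Local Notation "A ^H" := (adjmx A) (format "A ^H").

(** * The local isometry of one party *)

Section OneSide.
Context {C : numClosedFieldType}.

Lemma adj_col_mul p q r (X : 'M[C]_(p, r)) (Y : 'M[C]_(q, r)) :
  (col_mx X Y)^H *m col_mx X Y = X^H *m X + Y^H *m Y.
Proof. by rewrite /adjmx map_col_mx tr_col_mx mul_row_col. Qed.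

(** Since [M i *m Psi = Psi *m (N i)^T], the range of [Psi] is invariant under [M i]. Compressing to
    it by [V] yields a [quad_rep], to which [quad_intertwiner] applies. *)
Lemma isometric_blocks n dA dB (Psi : 'M[C]_(dA, dB)) (M : 'I_4 -> 'M[C]_dA)
    (N : 'I_4 -> 'M[C]_dB) (P : 'I_4 -> 'M[C]_n) rho' :
  (0 < n)%N -> quad_rep n P rho' ->
  (forall i, (M i)^H = M i) -> (forall i, (N i)^H = N i) ->
  (forall i, M i *m Psi = Psi *m (N i)^T) ->
  (forall i, M i *m (M i *m Psi) = M i *m Psi) ->
  (\sum_(i < 4) M i) *m Psi = (2 - n%:R^-1) *: Psi ->
  \tr (Psi^H *m Psi) = 1 ->
  (forall i, \tr (Psi^H *m (M i *m Psi)) = rank_ratio n i) ->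
  exists k (u : 'I_n -> 'M[C]_(k, dA)),
    \sum_x (u x)^H *m u x = 1%:M /\
    forall i x, u x *m (M i *m Psi) = \sum_y P i x y *: (u y *m Psi).
Proof.
move=> n0 qP Mh Nh MPsi MMPsi sumM tr1 trM.
have [r [V [D [V1 VD VPsi]]]] := orthonormal_colspan Psi.
pose Q i := V^H *m M i *m V; pose Psi0 := V^H *m Psi.
have PsiE : V *m Psi0 = Psi by rewrite mulmxA.
have Psi0D : Psi0 *m D = 1%:M by rewrite -mulmxA -VD.
have Qh i : (Q i)^H = Q i by rewrite !adjmxM adjmxK Mh mulmxA.
have proj i : V *m (V^H *m (M i *m Psi)) = M i *m Psi.
  by rewrite MPsi !mulmxA VPsi.
have MV i : M i *m V = V *m Q i.
  have e : M i *m V = M i *m Psi *m D by rewrite -mulmxA -VD.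
  by rewrite /Q -(mulmxA V^H) e !mulmxA -(mulmxA _ _ Psi) -(mulmxA V) proj.
have QV i : Q i *m Psi0 = V^H *m (M i *m Psi).
  by rewrite /Psi0 /Q -!mulmxA (mulmxA V) VPsi.
have cancel (X Y : 'M_r) : X *m Psi0 = Y *m Psi0 -> X = Y.
  by move/(congr1 (mulmx^~ D)); rewrite -!(mulmxA _ Psi0) Psi0D !mulmx1.
have QPsi i : Q i *m Psi0 = Psi0 *m (N i)^T.
  by rewrite QV MPsi mulmxA.
have q : quad_rep n Q (Psi0 *m Psi0^H).
  split=> //.
  - move=> i; apply: cancel; rewrite -mulmxA QPsi mulmxA !QV -mulmxA -mulmxA -MPsi.
    by rewrite MMPsi -QPsi QV.
  - apply: cancel; rewrite mulmx_suml (eq_bigr _ (fun i _ => QV i)) -mulmx_sumr.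
    by rewrite -mulmx_suml sumM mul_scalar_mx -scalemxAr.
  (* [Q i] crosses [Psi0] by becoming [(N i)^T] and crosses back through [Psi0^H], hence commutes
     with the density. *)
  - move=> i; have e : Psi0^H *m Q i = (N i)^T *m Psi0^H.
      by rewrite -{1}(Qh i) -adjmxM QPsi [LHS]adjmxM adjmx_tr Nh.
    by rewrite -[LHS]mulmxA e [LHS]mulmxA -QPsi -[LHS]mulmxA.
  - move=> k G tr0; have : Psi0^H *m G = 0.
      apply/mxtrace_adjmul_eq0/(etrans _ tr0).
      by rewrite [(_ *m G)^H]adjmxM adjmxK -mulmxA mxtrace_mulC !mulmxA.
    move/(congr1 (mulmx D^H)); rewrite mulmxA -adjmxM Psi0D adjmx1 mul1mx mulmx0.
    by [].
  - rewrite mxtrace_mulC -tr1 adjmxM adjmxK -mulmxA; congr (\tr (_ *m _)).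
    by rewrite -[RHS]VPsi mulmxA.
  - move=> i; rewrite -mulmxA mxtrace_mulC -mulmxA QV adjmxM adjmxK -mulmxA proj.
    exact: trM.
have [k [u [u1 uQ]]] := quad_intertwiner n0 qP q.
pose x0 := Ordinal n0.
(* The [dA] extra dimensions absorb the complement of the range of [Psi], where
   the measurements are unconstrained. *)
exists (k + dA)%N, (fun x => col_mx (u x *m V^H) ((x == x0)%:R *: (1%:M - V *m V^H))).
have Rh : (1%:M - V *m V^H)^H = 1%:M - V *m V^H.
  by rewrite adjmxB adjmx1 adjmxM adjmxK.
have RPsi : (1%:M - V *m V^H) *m Psi = 0.
  by rewrite mulmxBl mul1mx VPsi subrr.
have RR : (1%:M - V *m V^H) *m (1%:M - V *m V^H) = 1%:M - V *m V^H.
  rewrite mulmxBr mulmx1 mulmxBl mul1mx -[V *m V^H *m _]mulmxA (mulmxA V^H) V1 mul1mx.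
  by rewrite subrr subr0.
split.
  rewrite (eq_bigr (fun x => V *m ((u x)^H *m u x) *m V^H
      + (x == x0)%:R *: (1%:M - V *m V^H))) => [|x _]; last first.
    rewrite adj_col_mul adjmxM adjmxK !mulmxA; congr (_ + _).
    rewrite adjmxZ Rh -scalemxAl -scalemxAr scalerA RR.
    by case: eqP; rewrite ?conjC1 ?conjC0 ?mul0r ?mul1r.
  rewrite big_split /= -mulmx_suml -mulmx_sumr u1 mulmx1 -scaler_suml.
  rewrite (bigD1 x0) //= ?eqxx big1 ?addr0 ?scale1r => [|x /negPf -> //].
  by rewrite addrC subrK.
move=> i x; rewrite mul_col_mx.
have -> : u x *m V^H *m (M i *m Psi) = \sum_y P i x y *: (u y *m V^H *m Psi).
  rewrite -PsiE (mulmxA (M i)) MV -(mulmxA _ V^H) !(mulmxA V^H) V1 mul1mx.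
  rewrite mulmxA uQ mulmx_suml; apply: eq_bigr => y _.
  by rewrite -scalemxAl -!mulmxA (mulmxA V^H) V1 mul1mx.
(* The padding component vanishes on both sides, because [1%:M - V *m V^H] kills [Psi]. *)
rewrite -scalemxAl MPsi mulmxA RPsi mul0mx scaler0.
rewrite (eq_bigr (fun y => col_mx (P i x y *: (u y *m V^H *m Psi)) 0)) => [|y _].
  by elim/big_ind2: _ => [|a b c d <- <-|//]; rewrite ?col_mx0 // add_col_mx addr0.
by rewrite mul_col_mx -scalemxAl RPsi scaler0 scale_col_mx scaler0.
Qed.
End OneSide.

Local Notation "A ^H" := (adjmx A) (format "A ^H").

(** * Correlations as bilinear expectations in the state matrix *)

Section Correlation.
Context {C : numClosedFieldType}.

Definition state_mx dA dB (v : 'cV[C]_(dA * dB)) : 'M[C]_(dA, dB) :=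
  \matrix_(i, j) v (mxtens_index (i, j)) 0.

Lemma sum_mxtens (V : nmodType) m n (F : 'I_(m * n) -> V) :
  \sum_k F k = \sum_i \sum_j F (mxtens_index (i, j)).
Proof.
rewrite pair_big /= (reindex (@mxtens_index m n)) /=; last first.
  by exists (@mxtens_unindex m n) => k _; rewrite ?mxtens_indexK ?mxtens_unindexK.
by apply: eq_bigr => -[i j].
Qed.

Lemma tens_state m p dA dB (A : 'M[C]_(m, dA)) (B : 'M[C]_(p, dB))
    (v : 'cV[C]_(dA * dB)) i j :
  ((A *t B) *m v) (mxtens_index (i, j)) 0 = (A *m state_mx v *m B^T) i j.
Proof.
rewrite mxE sum_mxtens mxE exchange_big; apply: eq_bigr => l _ /=.
rewrite !mxE mulr_suml; apply: eq_bigr => k _; rewrite !mxE !mxtens_indexK /=.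
by rewrite mulrAC.
Qed.

Definition expect dA dB (Psi : 'M[C]_(dA, dB)) A B := \tr (Psi^H *m A *m Psi *m B^T).

Lemma expectE dA dB (v : 'cV[C]_(dA * dB)) A B :
  (v^H *m (A *t B) *m v) 0 0 = expect (state_mx v) A B.
Proof.
have -> : expect (state_mx v) A B = \tr ((state_mx v)^H *m (A *m state_mx v *m B^T)).
  by rewrite /expect !mulmxA.
rewrite -mulmxA mxE sum_mxtens.
rewrite /mxtrace exchange_big; apply: eq_bigr => j _; rewrite mxE.
apply: eq_bigr => i _; rewrite tens_state.
by rewrite !adjmxE !mxE.
Qed.

Lemma state_norm dA dB (v : 'cV[C]_(dA * dB)) :
  v^H *m v = 1%:M -> \tr ((state_mx v)^H *m state_mx v) = 1.
Proof.
move/matrixP/(_ 0 0); rewrite [RHS]mxE eqxx mulr1n mxE sum_mxtens => <-.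
rewrite /mxtrace exchange_big; apply: eq_bigr => j _; rewrite mxE.
by apply: eq_bigr => i _; rewrite !mxE.
Qed.

Lemma expect_sum dA dB (Psi : 'M[C]_(dA, dB)) (I J : finType) (c : I -> C) (d : J -> C)
    (M : I -> 'M[C]_dA) (N : J -> 'M[C]_dB) :
  expect Psi (\sum_i c i *: M i) (\sum_j d j *: N j) =
  \sum_i \sum_j c i * d j * expect Psi (M i) (N j).
Proof.
rewrite /expect mulmx_sumr !mulmx_suml mxtrace_sum; apply: eq_bigr => i _.
rewrite linear_sum mulmx_sumr mxtrace_sum; apply: eq_bigr => j _ /=.
by rewrite [(d j *: N j)^T]linearZ /= -!(scalemxAr, scalemxAl) !mxtraceZ mulrA [d j * _]mulrC.
Qed.

Lemma sum_delta d (M : 'I_4 * 'I_2 -> 'M[C]_d) p0 : \sum_p (p == p0)%:R *: M p = M p0.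
Proof.
by rewrite (bigD1 p0) //= eqxx scale1r big1 ?addr0 // => p /negPf ->; rewrite scale0r.
Qed.

(** Splitting the identity into the outcomes of setting 0 gives access to marginals. *)
Lemma sum_first d (M : 'I_4 -> 'I_2 -> 'M[C]_d) :
  (forall i, \sum_a M i a = 1%:M) ->
  \sum_p (p.1 == ord0)%:R *: M p.1 p.2 = 1%:M.
Proof.
move=> M1; rewrite -(pair_bigA _ (fun i a => (i == ord0)%:R *: M i a)) /=.
rewrite (bigD1 ord0) //= [X in _ + X]big1 ?addr0 => [|i /negPf ->].
  by rewrite -(M1 ord0); apply: eq_bigr => a _; rewrite scale1r.
by rewrite big1 // => a _; rewrite scale0r.
Qed.

(** Each of the four settings resolves the identity, so the shift by [alpha] is spread as
    [alpha / 4] over all of them. *)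
Lemma sum_shifted d (M : 'I_4 -> 'I_2 -> 'M[C]_d) alpha :
  (forall i, \sum_a M i a = 1%:M) ->
  \sum_p ((p.2 == ord0)%:R - alpha / 4%:R) *: M p.1 p.2 = \sum_i M i ord0 - alpha%:M.
Proof.
move=> M1; rewrite -(pair_bigA _ (fun i a => ((a == ord0)%:R - alpha / 4%:R) *: M i a)) /=.
rewrite (eq_bigr (fun i => M i ord0 - (alpha / 4%:R)%:M)) => [|i _].
  rewrite sumrB sumr_const card_ord -raddfMn /=; congr (_ - _%:M).
  by rewrite -[_ / _ *+ _]mulr_natr divfK // pnatr_eq0.
rewrite (eq_bigr (fun a => (a == ord0)%:R *: M i a - (alpha / 4%:R) *: M i a)); last first.
  by move=> a _; rewrite scalerBl.
rewrite sumrB -scaler_sumr M1 scalemx1; congr (_ - _).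
rewrite (bigD1 ord0) //= scale1r big1 ?addr0 // => a /negPf ->.
by rewrite scale0r.
Qed.

(** By positivity, each vanishing expectation annihilates the state itself, so [M *m Psi] and
    [Psi *m N^T] both equal [M *m Psi *m N^T]. *)
Lemma perfect_correlation dA dB (Psi : 'M[C]_(dA, dB)) (M : 'M[C]_dA) (N : 'M[C]_dB) :
  psd M -> psd (1%:M - M) -> psd N -> psd (1%:M - N) ->
  expect Psi M (1%:M - N) = 0 -> expect Psi (1%:M - M) N = 0 ->
  M *m Psi = Psi *m N^T /\ M *m (M *m Psi) = M *m Psi.
Proof.
move=> pM pM' pN pN' e1 e2.
have h1 : M *m Psi = M *m Psi *m N^T.
  have := psd_mul_eq0 pM pN' e1; rewrite linearB /= trmx1 mulmxBr mulmx1.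
  by move/eqP; rewrite subr_eq0 => /eqP.
have h2 : Psi *m N^T = M *m Psi *m N^T.
  have := psd_mul_eq0 pM' pN e2; rewrite !mulmxBl mul1mx.
  by move/eqP; rewrite subr_eq0 => /eqP.
have h : M *m Psi = Psi *m N^T by rewrite h1 h2.
by split => //; rewrite {1}h mulmxA -h1.
Qed.
End Correlation.

(** * Schur's lemma *)

Section Assembly.
Context {C : numClosedFieldType}.

Definition irreducible_family n (Q : 'I_4 -> 'M[C]_n) :=
  forall U : 'M[C]_n, (forall i, (U *m Q i <= U)%MS) -> \rank U = 0%N \/ \rank U = n.

(** An eigenvalue of [B] exists over a closed field; its eigenspace is nonzero and invariant under
    whatever commutes with [B], hence is everything. *)
Lemma schur_scalar n (Q : 'I_4 -> 'M[C]_n) (B : 'M[C]_n) : (0 < n)%N ->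
  irreducible_family Q -> (forall i, Q i *m B = B *m Q i) -> exists c, B = c%:M.
Proof.
move=> n0 irr comm; have [a Ba] := eigenvalue_closed B n0.
exists a; have [i| |rU] := irr (eigenspace B a).
- apply/eigenspaceP; rewrite -mulmxA comm mulmxA.
  by rewrite (eigenspaceP (submx_refl _)) -scalemxAl.
- by move/eqP; rewrite mxrank_eq0; move: Ba; rewrite /eigenvalue => /negPf ->.
have /eigenspaceP : (1%:M <= eigenspace B a)%MS by rewrite sub1mx /row_full rU eqxx.
by rewrite mul1mx scalemx1.
Qed.
End Assembly.

Local Notation "A ^H" := (adjmx A) (format "A ^H").

(** * Self-testing over a closed field: both local isometries and the auxiliary state *)

Section Core.
Context {C : numClosedFieldType}.

Lemma state_mx_phi n : state_mx (phi_state n) = ((sqrtC (n%:R : C))^-1)%:M.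
Proof.
apply/matrixP => i j; rewrite !mxE mxtens_indexK /=.
by case: (i == j); rewrite ?mulr1n ?mulr0n.
Qed.

Lemma expect_phi n (A B : 'M[C]_n) :
  expect (state_mx (phi_state n)) A B = n%:R^-1 * \tr (A *m B^T).
Proof.
have sR : ((sqrtC (n%:R : C))^-1)^* = (sqrtC n%:R)^-1.
  by rewrite conj_Creal // ger0_real // invr_ge0 sqrtC_ge0 ler0n.
rewrite /expect state_mx_phi adj_scalar_mx sR mul_scalar_mx mul_mx_scalar.
by rewrite scalerA -scalemxAl mxtraceZ -invfM -expr2 sqrtCK.
Qed.

(** The operator sum_x |x> (x) [u x], assembled from its blocks. *)
Definition stack m k d (u : 'I_m -> 'M[C]_(k, d)) : 'M[C]_(m * k, d) :=
  \matrix_(I, c) u (mxtens_unindex I).1 (mxtens_unindex I).2 c.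

Lemma stackE m k d e (u : 'I_m -> 'M[C]_(k, d)) (X : 'M[C]_(d, e)) x i j :
  (stack u *m X) (mxtens_index (x, i)) j = (u x *m X) i j.
Proof. by rewrite !mxE; apply: eq_bigr => c _; rewrite mxE mxtens_indexK. Qed.

Lemma stack_iso m k d (u : 'I_m -> 'M[C]_(k, d)) :
  \sum_x (u x)^H *m u x = 1%:M -> (stack u)^H *m stack u = 1%:M.
Proof.
move=> <-; apply/matrixP => i j; rewrite mxE sum_mxtens summxE.
apply: eq_bigr => x _; rewrite mxE; apply: eq_bigr => l _.
by rewrite !mxE mxtens_indexK.
Qed.

Section SelfTest.
Context (n : nat) (P : 'I_4 -> 'M[C]_n) (T : 'I_4 -> 'I_2 -> 'M[C]_n).
Hypothesis n_gt0 : (0 < n)%N.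
Hypothesis Ph : forall i, (P i)^H = P i.
Hypothesis Psym : forall i, (P i)^T = P i.
Hypothesis Pidem : forall i, P i *m P i = P i.
Hypothesis Psum : \sum_(i < 4) P i = (2 - n%:R^-1)%:M.
Hypothesis Ptr : forall i, n%:R^-1 * \tr (P i) = rank_ratio n i.
Hypothesis Pirr : irreducible_family P.
Hypothesis TE : forall i a, T i a = if a == ord0 then P i else 1%:M - P i.

Let nR : n%:R != 0 :> C. Proof. by rewrite pnatr_eq0 -lt0n. Qed.

Lemma quad_rep_ideal : quad_rep n P (n%:R^-1)%:M.
Proof.
split => //.
- by move=> i; rewrite scalar_mxC.
- move=> k G; rewrite mul_scalar_mx mxtraceZ => /eqP.
  rewrite mulf_eq0 invr_eq0 (negPf nR) /= mxtrace_mulC => /eqP.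
  exact: mxtrace_adjmul_eq0.
- by rewrite mxtrace_scalar -[_^-1 *+ n]mulr_natr mulVf.
- by move=> i; rewrite mul_scalar_mx mxtraceZ.
Qed.

Lemma T_sum i : \sum_a T i a = 1%:M.
Proof. by rewrite !big_ord_recl big_ord0 !TE /= addr0 addrC subrK. Qed.

Lemma two_outcomes d (M : 'I_2 -> 'M[C]_d) a :
  \sum_a M a = 1%:M -> M a = if a == ord0 then M ord0 else 1%:M - M ord0.
Proof.
rewrite !big_ord_recl big_ord0 addr0 => <-; case: eqP => [->|] //.
case: a => [[|[|//]] i2] a0; first by case: a0; apply: val_inj.
by rewrite [RHS]addrC addKr; congr M; apply: val_inj.
Qed.

Context (S : strategy C 4 4 2) (S_valid : valid_strategy S).
Hypothesis corr : forall i j a b, correlation S i j a b =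
  correlation (@Strategy C 4 4 2 n n (phi_state n) T T) i j a b.

Let Psi := state_mx (state S).
Let M i := measA S i ord0.
Let N i := measB S i ord0.

Let MA_sum i : \sum_a measA S i a = 1%:M.
Proof. by case: S_valid => _ [/(_ i)[]]. Qed.
Let NB_sum i : \sum_a measB S i a = 1%:M.
Proof. by case: S_valid => _ [_ /(_ i)[]]. Qed.
Let M_psd i a : psd (measA S i a).
Proof. by case: S_valid => _ [/(_ i)[]]. Qed.
Let N_psd i a : psd (measB S i a).
Proof. by case: S_valid => _ [_ /(_ i)[]]. Qed.

(** Bilinearity extends the agreement of correlations to all linear combinations of outcomes; on the
    ideal side the expectation is a normalized trace. *)
Lemma expect_agree (c d : 'I_4 * 'I_2 -> C) :
  expect Psi (\sum_p c p *: measA S p.1 p.2) (\sum_p d p *: measB S p.1 p.2) =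
  n%:R^-1 * \tr ((\sum_p c p *: T p.1 p.2) *m (\sum_p d p *: T p.1 p.2)^T).
Proof.
rewrite -expect_phi !expect_sum; apply: eq_bigr => p _; apply: eq_bigr => q _.
by congr (_ * _); rewrite -!expectE; apply: corr.
Qed.

Lemma M_compl i : measA S i ord_max = 1%:M - M i.
Proof. by rewrite (two_outcomes _ (MA_sum i)). Qed.

Lemma N_compl i : measB S i ord_max = 1%:M - N i.
Proof. by rewrite (two_outcomes _ (NB_sum i)). Qed.

Lemma same_setting i : M i *m Psi = Psi *m (N i)^T /\ M i *m (M i *m Psi) = M i *m Psi.
Proof.
have PP0 : P i *m (1%:M - P i)^T = 0.
  by rewrite linearB /= trmx1 Psym mulmxBr mulmx1 Pidem subrr.
have PP0' : (1%:M - P i) *m (P i)^T = 0.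
  by rewrite Psym mulmxBl mul1mx Pidem subrr.
have agree a b := expect_agree (fun p => (p == (i, a))%:R) (fun p => (p == (i, b))%:R).
apply: perfect_correlation; rewrite -?M_compl -?N_compl;
  [exact: M_psd | exact: M_psd | exact: N_psd | exact: N_psd | | ].
- have := agree ord0 ord_max; rewrite !sum_delta /= => e; apply: (etrans e).
  by rewrite !TE /= PP0 mxtrace0 mulr0.
- have := agree ord_max ord0; rewrite !sum_delta /= => e; apply: (etrans e).
  by rewrite !TE /= PP0' mxtrace0 mulr0.
Qed.

Lemma marginal i : \tr (Psi^H *m (M i *m Psi)) = rank_ratio n i.
Proof.
have := expect_agree (fun p => (p == (i, ord0))%:R) (fun p => (p.1 == ord0)%:R).
rewrite !sum_delta !sum_first //=; last exact: T_sum.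
by rewrite /expect trmx1 !mulmx1 -mulmxA => ->; rewrite TE eqxx trmx1 mulmx1 Ptr.
Qed.

Lemma sum_M : (\sum_(i < 4) M i) *m Psi = (2 - n%:R^-1) *: Psi.
Proof.
set alpha := 2 - _; have alphaC : alpha^* = alpha.
  by rewrite rmorphB /= fmorphV !rmorph_nat.
pose c (p : 'I_4 * 'I_2) : C := (p.2 == ord0)%:R - alpha / 4%:R.
have := expect_agree c c; rewrite !sum_shifted //; last exact: T_sum.
have -> : \sum_i T i ord0 = alpha%:M.
  by rewrite -Psum; apply: eq_bigr => i _; rewrite TE eqxx.
rewrite subrr mul0mx mxtrace0 mulr0 /expect.
set X := \sum_i M i - alpha%:M; set Y := \sum_i _ - _.
have XPsi : X *m Psi = Psi *m Y^T.
  rewrite /X /Y linearB /= mulmxBl mulmxBr linear_sum /= mulmx_suml mulmx_sumr.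
  rewrite tr_scalar_mx scalar_mxC; congr (_ - _).
  by apply: eq_bigr => i _; case: (same_setting i).
have Xh : X^H = X.
  rewrite adjmxB adj_scalar_mx alphaC adjmx_sum; congr (_ - _).
  by apply: eq_bigr => i _; case: (M_psd i ord0).
(* Moving [Y] across the state turns the vanishing expectation into the squared norm of
   [X *m Psi]. *)
rewrite -mulmxA -XPsi => e; have : X *m Psi = 0.
  by apply: mxtrace_adjmul_eq0; rewrite adjmxM Xh.
by rewrite /X mulmxBl mul_scalar_mx => /eqP; rewrite subr_eq0 => /eqP.
Qed.

Lemma Psi_norm : \tr (Psi^H *m Psi) = 1.
Proof. by apply: state_norm; case: S_valid. Qed.

Lemma blocks_A : exists k (u : 'I_n -> 'M[C]_(k, dimA S)),
    \sum_x (u x)^H *m u x = 1%:M /\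
    forall i x, u x *m (M i *m Psi) = \sum_y P i x y *: (u y *m Psi).
Proof.
apply: (isometric_blocks (N := N) n_gt0 quad_rep_ideal) => [i|i|i|i|||].
- by case: (M_psd i ord0).
- by case: (N_psd i ord0).
- by case: (same_setting i).
- by case: (same_setting i).
- exact: sum_M.
- exact: Psi_norm.
- exact: marginal.
Qed.

Lemma N_Psi i : N i *m Psi^T = Psi^T *m (M i)^T.
Proof. by rewrite -trmx_mul (same_setting i).1 trmx_mul trmxK. Qed.

(** Exchanging the parties replaces [Psi] by its transpose and swaps [M] and [N], so the one-sided
    construction applies again. *)
Lemma blocks_B : exists k (u : 'I_n -> 'M[C]_(k, dimB S)),
    \sum_x (u x)^H *m u x = 1%:M /\
    forall i x, u x *m (N i *m Psi^T) = \sum_y P i x y *: (u y *m Psi^T).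
Proof.
apply: (isometric_blocks (N := M) n_gt0 quad_rep_ideal) => [i|i|i|i|||i].
- by case: (N_psd i ord0).
- by case: (M_psd i ord0).
- exact: N_Psi.
- rewrite N_Psi mulmxA N_Psi -mulmxA -!trmx_mul; congr (_^T).
  by rewrite -mulmxA; case: (same_setting i).
- rewrite mulmx_suml (eq_bigr _ (fun i _ => N_Psi i)) -mulmx_sumr -linear_sum /=.
  by rewrite -trmx_mul sum_M linearZ.
- by rewrite adjmx_tr -trmx_mul mxtrace_tr mxtrace_mulC Psi_norm.
- by rewrite N_Psi -trmx_mul adjmx_tr -trmx_mul mxtrace_tr mxtrace_mulC marginal.
Qed.


(** For fixed auxiliary indices [k] and [l], the entries of [Phi] form a matrix commuting with the
    symmetric [P i], hence a scalar matrix by Schur. *)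
Lemma corner_blocks kA kB (Phi : 'I_n -> 'I_n -> 'M[C]_(kA, kB)) :
  (forall i x z, \sum_y P i x y *: Phi y z = \sum_y P i z y *: Phi x y) ->
  exists W, forall x y, Phi x y = (x == y)%:R *: W.
Proof.
move=> comm; pose x0 := Ordinal n_gt0; exists (Phi x0 x0) => x y.
apply/matrixP => k l; pose B := \matrix_(x, y) Phi x y k l.
have [|c Bc] := @schur_scalar C n P B n_gt0 Pirr.
  move=> i; apply/matrixP => x' z.
  have := congr1 (fun X : 'M_(kA, kB) => X k l) (comm i x' z).
  rewrite !summxE !mxE => e.
  transitivity (\sum_y (P i x' y *: Phi y z) k l).
    by apply: eq_bigr => y' _; rewrite !mxE.
  rewrite e; apply: eq_bigr => y' _; rewrite !mxE mulrC -{1}Psym mxE.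
  by [].
have BE x' y' : Phi x' y' k l = c *+ (x' == y').
  by have := congr1 (fun X : 'M_n => X x' y') Bc; rewrite /B !mxE.
by rewrite mxE !BE eqxx mulr_natl.
Qed.

Lemma outcome_blocks d e k (m : 'I_4 -> 'I_2 -> 'M[C]_d) (X : 'M[C]_(d, e))
    (u : 'I_n -> 'M[C]_(k, d)) :
  (forall i, \sum_a m i a = 1%:M) ->
  (forall i x, u x *m (m i ord0 *m X) = \sum_y P i x y *: (u y *m X)) ->
  forall i a x, u x *m (m i a *m X) = \sum_y T i a x y *: (u y *m X).
Proof.
move=> m1 um i a x; rewrite (two_outcomes a (m1 i)) TE; case: eqP => _; first exact: um.
rewrite mulmxBl mulmxBr mul1mx um.
rewrite [RHS](eq_bigr (fun y => (x == y)%:R *: (u y *m X) - P i x y *: (u y *m X))).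
  rewrite sumrB; congr (_ - _); rewrite (bigD1 x) //= eqxx scale1r big1 ?addr0 // => y.
  by rewrite eq_sym => /negPf ->; rewrite scale0r.
by move=> y _; rewrite !mxE scalerBl.
Qed.

Lemma local_dilation_ideal :
  local_dilation (@Strategy C 4 4 2 n n (phi_state n) T T) S.
Proof.
have [kA [u [u1 uM]]] := blocks_A; have [kB [w [w1 wN]]] := blocks_B.
pose Phi x y := u x *m Psi *m (w y)^T.
(* [Phi] lists the blocks of the image of the state under the two isometries. Moving [M i] across
   [Psi] to [(N i)^T] evaluates the same block from either side, which gives the commutation. *)
have [i x z|W PhiW] := @corner_blocks kA kB Phi.
  transitivity (u x *m (M i *m Psi) *m (w z)^T).
    by rewrite uM mulmx_suml; apply: eq_bigr => y _; rewrite -scalemxAl.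
  rewrite (same_setting i).1 -[in LHS](trmxK Psi) -trmx_mul -[LHS]mulmxA -trmx_mul wN.
  rewrite linear_sum /= mulmx_sumr; apply: eq_bigr => y _.
  by rewrite linearZ /= -scalemxAr trmx_mul trmxK mulmxA.
have normPhi : \sum_x \sum_y \tr ((Phi x y)^H *m Phi x y) = 1.
  transitivity (\tr (Psi^H *m (\sum_x (u x)^H *m u x) *m Psi *m (\sum_y (w y)^H *m w y)^T)).
    rewrite mulmx_sumr !mulmx_suml mxtrace_sum; apply: eq_bigr => x _.
    rewrite linear_sum mulmx_sumr mxtrace_sum; apply: eq_bigr => y _ /=.
    rewrite !adjmxM trmx_mul adjmx_tr -!mulmxA mxtrace_mulC !mulmxA.
    by [].
  by rewrite u1 w1 trmx1 !mulmx1 Psi_norm.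
have nW : n%:R * \tr (W^H *m W) = 1.
  rewrite -[RHS]normPhi mulr_natl -{1}(card_ord n) -sumr_const; apply: eq_bigr => x _.
  rewrite (bigD1 x) //= PhiW eqxx scale1r big1 ?addr0 // => y.
  by rewrite PhiW eq_sym => /negPf ->; rewrite scale0r mulmx0 mxtrace0.
have sR : (sqrtC (n%:R : C))^* = sqrtC n%:R.
  by rewrite conj_Creal // ger0_real // sqrtC_ge0 ler0n.
(* The image has [n] equal diagonal blocks [W], whereas [phi_state] has diagonal entries 1/sqrt(n);
   the factor sqrt(n) compensates and normalizes [aux]. *)
pose aux : 'cV[C]_(kA * kB) :=
  \col_I (sqrtC n%:R * W (mxtens_unindex I).1 (mxtens_unindex I).2).
have auxE k l : aux (mxtens_index (k, l)) 0 = sqrtC n%:R * W k l.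
  by rewrite mxE mxtens_indexK.
exists kA, kB, aux, (stack u), (stack w).
split; [|exact: stack_iso|exact: stack_iso|].
  apply/matrixP => i j; rewrite !ord1 mxE [RHS]mxE eqxx mulr1n -[RHS]nW sum_mxtens.
  rewrite mulr_sumr exchange_big; apply: eq_bigr => l _ /=; rewrite [in RHS]mxE mulr_sumr.
  apply: eq_bigr => k _; rewrite !adjmxE auxE rmorphM /= sR.
  by rewrite mulrACA -expr2 sqrtCK.
move=> i j a b x k y l /=.
rewrite tensmxE tens_state state_mx_phi tensmx_mul tens_state.
rewrite auxE mul_mx_scalar -scalemxAl [in RHS]mxE.
rewrite mulrACA mulVf ?mul1r; last by rewrite sqrtC_eq0.
rewrite -/Psi.
transitivity ((u x *m (measA S i a *m Psi) *m (w y *m measB S j b)^T) k l).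
  rewrite -(mulmxA (stack u)) mxE [RHS]mxE; apply: eq_bigr => c _.
  by rewrite stackE ![((_ *m _)^T) _ _]mxE stackE.
(* The second party's operator becomes [T j b] on the blocks, and diagonality of [Phi] leaves one
   summand. *)
have uPhi z : u z *m Psi *m (w y *m measB S j b)^T = T j b y z *: W.
  rewrite -[in LHS](trmxK Psi) -mulmxA -trmx_mul -mulmxA (outcome_blocks NB_sum wN).
  rewrite linear_sum mulmx_sumr (bigD1 z) //= big1 ?addr0 => [|y' yz].
    rewrite linearZ /= -scalemxAr trmx_mul trmxK mulmxA -/(Phi z z) PhiW eqxx.
    by rewrite scale1r.
  rewrite linearZ /= -scalemxAr trmx_mul trmxK mulmxA -/(Phi z y') PhiW.
  by rewrite eq_sym (negPf yz) scale0r scaler0.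
rewrite (outcome_blocks MA_sum uM) mulmx_suml summxE mxE mulr_suml; apply: eq_bigr => z _.
by rewrite -scalemxAl uPhi scalerA !mxE.
Qed.
End SelfTest.
End Core.

(** * Traces from ranks, and the passage from real to complex matrices *)

(** In a full-rank factorization [A = U *m V], idempotence forces [V *m U = 1%:M], and the trace is
    cyclic. *)
Lemma mxtrace_idempotent (F : fieldType) n (A : 'M[F]_n) :
  A *m A = A -> \tr A = (\rank A)%:R.
Proof.
move=> AA; have := (row_base_free A, col_base_full A, mulmx_base A).
move: (row_base A) (col_base A) => V U [[Vfree Ufull] UV].
have e : V *m U = 1%:M.
  apply: (row_free_inj Vfree); apply: (row_full_inj Ufull).
  by rewrite mul1mx !mulmxA UV -mulmxA UV AA.
by rewrite -{1}UV mxtrace_mulC e mxtrace1.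
Qed.

Lemma cmxE (R : realType) m n (A : 'M[R]_(m, n)) : cmx A = map_mx (real_complex R) A.
Proof. by []. Qed.

Lemma adj_cmx (R : realType) m n (A : 'M[R]_(m, n)) : (cmx A)^H = cmx A^T.
Proof.
by apply/matrixP => i j; rewrite !mxE /RtoC conj_Creal // complex_real.
Qed.

Theorem theorem5p2 (R : realType) (n : nat) (P : 'I_4 -> 'M[R]_n) :
  (0 < n)%N -> frak_P_quadruple P -> self_tested (S_strategy P).
Proof.
move=> n_gt0 [Pproj Psum [rank0 rank1] Pirr] S S_valid corr.
have Psym i : (cmx (P i))^T = cmx (P i) by rewrite cmxE map_trmx (Pproj i).1.
apply: (@local_dilation_ideal _ n (fun i => cmx (P i)) (proj_meas P)) => //.
- by move=> i; rewrite adj_cmx (Pproj i).1.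
- by move=> i; rewrite cmxE -map_mxM (Pproj i).2.
- transitivity (map_mx (real_complex R) (\sum_(i < 4) P i)); first by rewrite map_mx_sum.
  by rewrite Psum map_scalar_mx /= rmorphB /= fmorphV /= !rmorph_nat.
- move=> i; rewrite cmxE trace_map_mx mxtrace_idempotent ?(Pproj i).2 //.
  rewrite rmorph_nat /rank_ratio mulrC; congr (_ / _).
  case: eqP => [->|/eqP i0]; last by rewrite rank1 // subr0.
  have := congr1 (fun z : int => z%:~R : R[i]) rank0.
  by rewrite rmorphB /= rmorphXn /= rmorphN1.
(* Invariant column subspaces appear in [Pirr] as row spaces under the transposes; by symmetry these
   are the matrices themselves. *)
- move=> U hU; apply: Pirr => i; rewrite Psym; exact: hU.
Qed.
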